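(* For $\xi\in\mathbb R$ let $g_\xi(x)=e^{2\pi i\xi x}$ and $\mathcal F(g_\xi)=\{e^{2\pi i nx}:n=0,1,2,\dots\}\cup\{e^{2\pi i(\xi+n)x}:n=-1,-2,\dots\}\subset L^2[-1/2,1/2]$. Then: (1) if $\xi<-1/2$, $\mathcal F(g_\xi)$ is not complete; (2) if $-1/2<\xi<1/2$, $\mathcal F(g_\xi)$ is a Riesz basis; (3) if $-1/2+n<\xi<1/2+n$ for some integer $n\ge1$, $\mathcal F(g_\xi)$ is a frame but not a Riesz basis; (4) if $\xi=-1/2+n$ for some integer $n\ge0$, $\mathcal F(g_\xi)$ is complete but is neither a Riesz basis nor a frame.
   Context: Complete: $\langle f,h_k\rangle=0$ for all $k$ implies $f=0$. Frame: $A\|f\|^2\le\sum_k|\langle f,h_k\rangle|^2\le B\|f\|^2$ for some $0<A\le B<\infty$ and all $f\in L^2[-1/2,1/2]$. Riesz basis: a frame such that every $f$ has a unique expansion $f=\sum_k\alpha_kh_k$. *)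

(* Defs.v *)
From HB Require Import structures.
From mathcomp Require Import all_boot all_order all_algebra.
From mathcomp Require Import all_classical all_reals all_analysis.
From mathcomp Require Import complex.
Set Implicit Arguments. Unset Strict Implicit. Unset Printing Implicit Defensive.
Import Order.TTheory GRing.Theory Num.Theory.
Import numFieldNormedType.Exports.
Local Open Scope classical_set_scope.
Local Open Scope ring_scope.

Section Frames.
Variable R : realType.

Definition I0 : set R := `[(- (1/2)) , 1/2]%classic.

Notation mu := (@lebesgue_measure R).

Definition L2 (f : R -> R[i]) : Prop :=
  measurable_fun I0 (fun x => complex.Re (f x)) /\
  measurable_fun I0 (fun x => complex.Im (f x)) /\
  mu.-integrable I0 (fun x => ((complex.Re (f x)) ^+ 2 + (complex.Im (f x)) ^+ 2)%:E).

Definition inner (f h : R -> R[i]) : R[i] :=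
  Complex (Rintegral mu I0 (fun x => complex.Re (f x * conjc (h x))))
          (Rintegral mu I0 (fun x => complex.Im (f x * conjc (h x)))).

Definition norm2 (f : R -> R[i]) : R :=
  Rintegral mu I0 (fun x => (complex.Re (f x)) ^+ 2 + (complex.Im (f x)) ^+ 2).

Definition cabs2 (z : R[i]) : R := (complex.Re z) ^+ 2 + (complex.Im z) ^+ 2.

Definition complete (F : int -> R -> R[i]) : Prop :=
  forall f, L2 f -> (forall k, inner f (F k) = 0) -> norm2 f = 0.

Definition frame (F : int -> R -> R[i]) : Prop :=
  exists A B : R, 0 < A /\ A <= B /\
    forall f, L2 f ->
      ((A * norm2 f)%:E <= \esum_(k in [set: int]) (cabs2 (inner f (F k)))%:E)%E /\
      (\esum_(k in [set: int]) (cabs2 (inner f (F k)))%:E <= (B * norm2 f)%:E)%E.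

Definition psum (alpha : int -> R[i]) (F : int -> R -> R[i]) (N : nat) : R -> R[i] :=
  fun x => \sum_(i < (2 * N).+1) alpha (i%:Z - N%:Z) * F (i%:Z - N%:Z) x.

Definition expansion (F : int -> R -> R[i]) (f : R -> R[i]) (alpha : int -> R[i]) : Prop :=
  (fun N : nat => norm2 (fun x => f x - psum alpha F N x)) @ \oo --> (0 : R).

Definition riesz_basis (F : int -> R -> R[i]) : Prop :=
  frame F /\ forall f, L2 f -> exists! alpha : int -> R[i], expansion F f alpha.

Definition cexp2pi (t : R) : R -> R[i] :=
  fun x => Complex (cos (2 * pi * t * x)) (sin (2 * pi * t * x)).

Definition Fg (xi : R) (k : int) : R -> R[i] :=
  if (0 <= k)%R then cexp2pi (k%:~R) else cexp2pi (xi + k%:~R).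

End Frames.

(* Main.v *)
(** Multiplying by [e^(-i pi xi x)] turns the family into the image of the Fourier basis
    [e_k] under [cos (pi xi x) -+ i sin (pi xi x)], with sign [-] for [k >= 0] and [+] for
    [k < 0].  For [|xi| < 1/2] the cosine strictly dominates the sine on the interval, so
    Parseval's identity yields the frame bounds and a lower Riesz bound; at [xi = -1/2] the
    domination is still strict away from the endpoints, which gives completeness.  A frame
    always has expansions (iterate [r |-> r - B^-1 sum <r, F_k> F_k]), and increasing [xi]
    by [n] adds [n] vectors, which destroys uniqueness.

    For [xi < -1/2] put [a = -xi - 1 > -1/2]: the function [cos (pi x)^a e^(i pi (xi - 1) x)]
    is orthogonal to the family.  As [a] decreases to [-1/2] its L2 norm blows up while its
    L1 norm stays bounded, so that no lower frame bound can hold at [xi = n - 1/2].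

    Parseval's identity holds because the L2 closure of the trigonometric polynomials is
    stable under products with its bounded members and under bounded pointwise limits: the
    sets whose indicator it contains form a sigma-algebra, and this contains the rays. *)

Require Import Defs.
From HB Require Import structures.
From mathcomp Require Import all_boot all_order all_algebra.
From mathcomp Require Import all_classical all_reals all_analysis.
From mathcomp Require Import complex.
From mathcomp Require Import measurable_realfun finmap ring lra zify.
Set Implicit Arguments. Unset Strict Implicit. Unset Printing Implicit Defensive.
Import Order.TTheory GRing.Theory Num.Theory.
Import numFieldNormedType.Exports HBNNSimple.
Local Open Scope classical_set_scope.
Local Open Scope ring_scope.

(** * Squared modulus *)

Section Cabs2.
Variable R : realType.
Implicit Types z w : R[i].

(** All norms are kept squared, so the role of the triangle inequality is played by [|z + w|^2 <= (1
    + t) |z|^2 + (1 + 1/t) |w|^2], with [t] chosen each time. For the frame bounds [t] is adapted to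
    the gap between the weights [cos^2] and [sin^2]: the sign of the sine part varies with the
    index, but it disappears in the sums of squares that Parseval's identity evaluates.

    Orthogonality of the annihilating function comes from integration by parts: differentiating
    [cos (pi x)^(a + 1)] times a sine or cosine links the moments of [cos (pi x)^a] at two
    frequencies two steps apart, and one coefficient vanishes exactly where the spectrum of the
    family begins. At [a = 0] the same moments give the orthonormality of the [e_k]. The singularity
    at the endpoints confines the calculus to compact subintervals exhausting the open interval.

    At [xi = n - 1/2] the test function annihilates a nearby family, that of [-1/2 - d]; only [n]
    vectors have no counterpart there, and the L1 bound controls those.

    In a frame expansion the function is given, so the only limits taken are those of single
    coefficients. *)

Lemma Re_add z w : complex.Re (z + w) = complex.Re z + complex.Re w.
Proof. by case: z; case: w. Qed.
Lemma Im_add z w : complex.Im (z + w) = complex.Im z + complex.Im w.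
Proof. by case: z; case: w. Qed.
Lemma Re_opp z : complex.Re (- z) = - complex.Re z.
Proof. by case: z. Qed.
Lemma Im_opp z : complex.Im (- z) = - complex.Im z.
Proof. by case: z. Qed.
Lemma Re_mul z w : complex.Re (z * w) =
  complex.Re z * complex.Re w - complex.Im z * complex.Im w.
Proof. by case: z; case: w. Qed.
Lemma Im_mul z w : complex.Im (z * w) =
  complex.Re z * complex.Im w + complex.Im z * complex.Re w.
Proof. by case: z; case: w. Qed.
Lemma Re_conjc z : complex.Re (conjc z) = complex.Re z.
Proof. by case: z. Qed.
Lemma Im_conjc z : complex.Im (conjc z) = - complex.Im z.
Proof. by case: z. Qed.

Lemma conjcD z w : conjc (z + w) = conjc z + conjc w.
Proof. by case: z; case: w => a b c d; rewrite /= opprD. Qed.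
Lemma conjcM z w : conjc (z * w) = conjc z * conjc w.
Proof. by case: z => a b; case: w => c d; congr Complex => /=; ring. Qed.

Definition ReImE := (Re_add, Im_add, Re_opp, Im_opp, Re_mul, Im_mul, Re_conjc, Im_conjc).

Lemma complexP z w : complex.Re z = complex.Re w -> complex.Im z = complex.Im w ->
  z = w.
Proof. by case: z; case: w => ? ? ? ? /= -> ->. Qed.

Lemma cabs2_ge0 z : 0 <= cabs2 z.
Proof. by rewrite /cabs2 addr_ge0// sqr_ge0. Qed.

Lemma cabs2_0 : cabs2 (0 : R[i]) = 0.
Proof. by rewrite /cabs2/= expr0n/= addr0. Qed.

Lemma cabs2_eq0 z : cabs2 z = 0 -> z = 0.
Proof.
rewrite /cabs2 => h; apply: complexP => /=; apply/eqP; rewrite -sqrf_eq0; nra.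
Qed.

Lemma cabs2M z w : cabs2 (z * w) = cabs2 z * cabs2 w.
Proof. by rewrite /cabs2 !ReImE; ring. Qed.

Lemma cabs2N z : cabs2 (- z) = cabs2 z.
Proof. by rewrite /cabs2 !ReImE !sqrrN. Qed.

(** In each coordinate the slack is the square [t^-1 (t a - b)^2]. The free weight [t] makes the
    constant in front of one term as close to 1 as wanted. *)
Lemma cabs2D_le t z w : 0 < t ->
  cabs2 (z + w) <= (1 + t) * cabs2 z + (1 + t^-1) * cabs2 w.
Proof.
move=> t0; rewrite /cabs2 !ReImE.
have key (a b : R) : (a + b) ^+ 2 <= (1 + t) * a ^+ 2 + (1 + t^-1) * b ^+ 2.
  rewrite -subr_ge0 (_ : _ - _ = t^-1 * (t * a - b) ^+ 2).
    by rewrite mulr_ge0 ?sqr_ge0// invr_ge0 ltW.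
  by field; rewrite gt_eqF.
have := key (complex.Re z) (complex.Re w).
have := key (complex.Im z) (complex.Im w); lra.
Qed.

Lemma cabs2D_le2 z w : cabs2 (z + w) <= 2 * cabs2 z + 2 * cabs2 w.
Proof. by have := @cabs2D_le 1 z w ltr01; rewrite invr1. Qed.

Lemma conjcK_mul z : z * conjc z = (cabs2 z)%:C%C.
Proof. by apply: complexP; rewrite /cabs2 !ReImE/=; ring. Qed.

Lemma ReC (a : R) : complex.Re a%:C%C = a. Proof. by []. Qed.
Lemma Re_sum I (r : seq I) (P : pred I) (F : I -> R[i]) :
  complex.Re (\sum_(i <- r | P i) F i) = \sum_(i <- r | P i) complex.Re (F i).
Proof. exact: (big_morph _ Re_add (erefl _)). Qed.
Lemma conjc_sum I (r : seq I) (P : pred I) (F : I -> R[i]) :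
  conjc (\sum_(i <- r | P i) F i) = \sum_(i <- r | P i) conjc (F i).
Proof. by apply: (big_morph _ conjcD); rewrite /= oppr0. Qed.

End Cabs2.

(** * The space L2 *)

Section L2space.
Variable R : realType.
Notation mu := (@lebesgue_measure R).
Notation I0 := (@I0 R).
Implicit Types (f g h m : R -> R[i]) (u v : R -> R).

Definition integrableI0 u := mu.-integrable I0 (EFin \o u).

Lemma measurable_I0 : measurable I0.
Proof. exact: measurable_itv. Qed.
Hint Resolve measurable_I0 : core.

Lemma measurable_I0L : @measurable _ (measurableTypeR R) I0.
Proof. exact: measurable_itv. Qed.
Hint Resolve measurable_I0L : core.

Lemma lebesgue_I0 : mu I0 = 1%:E.
Proof. by rewrite /I0 lebesgue_measure_itv/= lte_fin ifT; [congr EFin|]; lra. Qed.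

Lemma integrableI0_meas u : integrableI0 u -> measurable_fun I0 u.
Proof. by move=> /measurable_int/measurable_EFinP. Qed.

Lemma integrableI0_le u v : measurable_fun I0 u -> (forall x, I0 x -> `|u x| <= v x) ->
  integrableI0 v -> integrableI0 u.
Proof.
move=> mu_ uv iv; apply: le_integrable iv => //; first exact/measurable_EFinP.
by move=> x Ix /=; rewrite lee_fin (le_trans (uv _ Ix))// ler_norm.
Qed.

Lemma integrableI0D u v : integrableI0 u -> integrableI0 v -> integrableI0 (fun x => u x + v x).
Proof. by move=> iu iv; apply: eq_integrable; last exact: (integrableD measurable_I0L iu iv). Qed.

Lemma integrableI0Z c u : integrableI0 u -> integrableI0 (fun x => c * u x).
Proof. by move=> iu; apply: eq_integrable; last exact: (integrableZl measurable_I0L c iu). Qed.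

Lemma integrableI0N u : integrableI0 u -> integrableI0 (fun x => - u x).
Proof. by move=> /(integrableI0Z (-1)); congr integrableI0; apply: funext => x; rewrite mulN1r. Qed.

Lemma integrableI0_cst c : integrableI0 (fun=> c).
Proof.
apply: measurable_bounded_integrable => //; first by rewrite [X in (X < _)%E]lebesgue_I0 ltry.
by exists `|c|; split => // M cM x _; apply: ltW.
Qed.

Lemma integrableI0_ext u v : (forall x, I0 x -> u x = v x) -> integrableI0 u -> integrableI0 v.
Proof.
move=> uv; by apply: eq_integrable => // x /set_mem Ix /=; rewrite uv.
Qed.

Notation "'\I' u" := (Rintegral mu I0 u) (at level 10, u at level 9).

Lemma RintD u v : integrableI0 u -> integrableI0 v -> \I (fun x => u x + v x) = \I u + \I v.
Proof. by move=> ? ?; apply: RintegralD. Qed.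
Lemma RintZ c u : integrableI0 u -> \I (fun x => c * u x) = c * \I u.
Proof. by move=> ?; apply: RintegralZl. Qed.
Lemma RintN u : integrableI0 u -> \I (fun x => - u x) = - \I u.
Proof.
by move=> iu; rewrite -mulN1r -RintZ//; congr Rintegral; apply/funext => x; rewrite mulN1r.
Qed.
Lemma Rint_le u v : integrableI0 u -> integrableI0 v ->
  (forall x, I0 x -> u x <= v x) -> \I u <= \I v.
Proof. by move=> ? ? ?; apply: le_Rintegral. Qed.
Lemma Rint_cst c : \I (fun=> c) = c.
Proof. by rewrite Rintegral_cst// [X in fine X]lebesgue_I0 mulr1. Qed.
Lemma Rint_ext u v : (forall x, I0 x -> u x = v x) -> \I u = \I v.
Proof. by move=> uv; apply: eq_Rintegral => x /set_mem; exact: uv. Qed.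

Definition cmeas f := measurable_fun I0 (fun x => complex.Re (f x)) /\
  measurable_fun I0 (fun x => complex.Im (f x)).

Lemma cmeasM f g : cmeas f -> cmeas g -> cmeas (fun x => f x * g x).
Proof.
move=> [a b] [c d]; split.
  under eq_fun do rewrite Re_mul.
  by apply: measurable_funB; apply: measurable_funM.
under eq_fun do rewrite Im_mul.
by apply: measurable_funD; apply: measurable_funM.
Qed.

Lemma cmeasD f g : cmeas f -> cmeas g -> cmeas (fun x => f x + g x).
Proof.
move=> [a b] [c d]; split.
  under eq_fun do rewrite Re_add.
  exact: measurable_funD.
under eq_fun do rewrite Im_add.
exact: measurable_funD.
Qed.

Lemma cmeas_cst c : cmeas (fun=> c).
Proof. by split; apply: measurable_cst. Qed.

Lemma cmeas_conj f : cmeas f -> cmeas (fun x => conjc (f x)).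
Proof.
move=> [a b]; split.
  by under eq_fun do rewrite Re_conjc.
under eq_fun do rewrite Im_conjc.
exact: measurableT_comp.
Qed.

Lemma cmeas_real u : measurable_fun I0 u -> cmeas (fun x => (u x)%:C%C).
Proof. by move=> mu_; split => //; apply: measurable_cst. Qed.

Lemma cmeas_cabs2 f : cmeas f -> measurable_fun I0 (fun x => cabs2 (f x)).
Proof. by move=> [a b]; apply: measurable_funD; apply: measurable_funX. Qed.

Lemma L2P f : L2 f <-> cmeas f /\ integrableI0 (fun x => cabs2 (f x)).
Proof. by split => [[a [b c]]|[[a b] c]]. Qed.

Lemma L2_meas f : L2 f -> cmeas f. Proof. by move=> /L2P[]. Qed.
Lemma L2_int f : L2 f -> integrableI0 (fun x => cabs2 (f x)). Proof. by move=> /L2P[]. Qed.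
Hint Resolve L2_meas L2_int : core.

Lemma norm2E f : norm2 f = \I (fun x => cabs2 (f x)).
Proof. by []. Qed.

Lemma L2_bmul m f (M : R) : cmeas m -> (forall x, I0 x -> cabs2 (m x) <= M) ->
  L2 f -> L2 (fun x => m x * f x).
Proof.
move=> mm mM fL; apply/L2P; split; first by apply: cmeasM => //; apply: L2_meas.
apply: (integrableI0_le _ _ (integrableI0Z M (L2_int fL))).
  by apply: cmeas_cabs2; apply: cmeasM => //; apply: L2_meas.
move=> x Ix; rewrite cabs2M ger0_norm ?mulr_ge0 ?cabs2_ge0//.
by rewrite ler_wpM2r ?cabs2_ge0// mM.
Qed.

Lemma L2D f g : L2 f -> L2 g -> L2 (fun x => f x + g x).
Proof.
move=> fL gL; apply/L2P; split; first by apply: cmeasD; apply: L2_meas.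
apply: (integrableI0_le _ _ (integrableI0D
  (integrableI0Z 2 (L2_int fL)) (integrableI0Z 2 (L2_int gL)))).
  by apply: cmeas_cabs2; apply: cmeasD => //; apply: L2_meas.
by move=> x Ix; rewrite ger0_norm ?cabs2_ge0// cabs2D_le2.
Qed.

Lemma L2Z c f : L2 f -> L2 (fun x => c * f x).
Proof. by apply: (L2_bmul (cmeas_cst c)) => x _; apply: lexx. Qed.

Lemma L2N f : L2 f -> L2 (fun x => - f x).
Proof. by move=> /(L2Z (-1)); congr L2; apply: funext => x; rewrite mulN1r. Qed.

Lemma L2B f g : L2 f -> L2 g -> L2 (fun x => f x - g x).
Proof. by move=> fL gL; apply: L2D => //; apply: L2N. Qed.

Lemma L2_bound m (M : R) : cmeas m -> (forall x, I0 x -> cabs2 (m x) <= M) -> L2 m.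
Proof.
move=> mm mM; apply/L2P; split => //; apply: (integrableI0_le _ _ (integrableI0_cst M)).
  exact: cmeas_cabs2.
by move=> x Ix; rewrite ger0_norm ?cabs2_ge0// mM.
Qed.

Lemma L2_cst (c : R[i]) : L2 (fun=> c).
Proof. by apply: L2_bound (cmeas_cst c) _ => x _; apply: lexx. Qed.

Lemma L2_sum I (r : seq I) (P : pred I) (F : I -> R -> R[i]) :
  (forall i, P i -> L2 (F i)) -> L2 (fun x => \sum_(i <- r | P i) F i x).
Proof.
move=> FL; elim: r => [|i r IH].
  by under eq_fun do rewrite big_nil; apply: L2_cst.
under eq_fun do rewrite big_cons.
by have [Pi|//] := boolP (P i); apply: L2D => //; apply: FL.
Qed.

(** Both parts are dominated by [|f|^2 + |g|^2]: the squares of sums and differences of coordinates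
    bound every product that occurs. *)
Lemma integrableI0_inner f g : L2 f -> L2 g ->
  integrableI0 (fun x => complex.Re (f x * conjc (g x))) /\
  integrableI0 (fun x => complex.Im (f x * conjc (g x))).
Proof.
move=> fL gL.
have ib := integrableI0D (L2_int fL) (L2_int gL).
have [m1 m2] := cmeasM (L2_meas fL) (cmeas_conj (L2_meas gL)).
split; apply: (integrableI0_le _ _ ib) => // x _; rewrite !ReImE /cabs2 ler_norml;
 move: (complex.Re (f x)) (complex.Im (f x)) (complex.Re (g x)) (complex.Im (g x));
 move=> a b c d; apply/andP; split;
 have := sqr_ge0 (a + c); have := sqr_ge0 (a - c); have := sqr_ge0 (b + d);
 have := sqr_ge0 (b - d); have := sqr_ge0 (a + d); have := sqr_ge0 (a - d);
 have := sqr_ge0 (b + c); have := sqr_ge0 (b - c); nra.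
Qed.

Lemma Re_inner f g : complex.Re (inner f g) = \I (fun x => complex.Re (f x * conjc (g x))).
Proof. by []. Qed.
Lemma Im_inner f g : complex.Im (inner f g) = \I (fun x => complex.Im (f x * conjc (g x))).
Proof. by []. Qed.

Lemma inner_conj f g : L2 f -> L2 g -> inner g f = conjc (inner f g).
Proof.
move=> fL gL; have [i1 i2] := integrableI0_inner fL gL.
apply: complexP; rewrite ?Re_conjc ?Im_conjc ?Re_inner ?Im_inner.
  by apply: Rint_ext => x _; rewrite !ReImE; ring.
by rewrite -RintN//; apply: Rint_ext => x _; rewrite !ReImE; ring.
Qed.

Lemma innerDl f g h : L2 f -> L2 g -> L2 h ->
  inner (fun x => f x + g x) h = inner f h + inner g h.
Proof.
move=> fL gL hL; have [i1 i2] := integrableI0_inner fL hL; have [i3 i4] := integrableI0_inner gL hL.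
apply: complexP; rewrite ?Re_add ?Im_add ?Re_inner ?Im_inner -RintD//;
  by apply: Rint_ext => x _; rewrite !ReImE; ring.
Qed.

Lemma innerZl c f h : L2 f -> L2 h -> inner (fun x => c * f x) h = c * inner f h.
Proof.
move=> fL hL; have [i1 i2] := integrableI0_inner fL hL.
apply: complexP; rewrite ?Re_mul ?Im_mul ?Re_inner ?Im_inner -!RintZ// -?RintN -?RintD//;
  try (by apply: integrableI0Z); try (by apply: integrableI0N; apply: integrableI0Z);
  by apply: Rint_ext => x _; rewrite !ReImE; ring.
Qed.

Lemma innerNl f h : L2 f -> L2 h -> inner (fun x => - f x) h = - inner f h.
Proof.
move=> fL hL; rewrite -mulN1r -innerZl//; congr inner.
by apply/funext => x; rewrite mulN1r.
Qed.

Lemma innerBl f g h : L2 f -> L2 g -> L2 h ->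
  inner (fun x => f x - g x) h = inner f h - inner g h.
Proof. by move=> fL gL hL; rewrite innerDl ?innerNl//; apply: L2N. Qed.

Lemma inner0l h : inner (fun=> 0) h = 0.
Proof.
by apply: complexP; rewrite ?Re_inner ?Im_inner -[RHS](Rint_cst 0);
   apply: Rint_ext => x _; rewrite !ReImE/=; ring.
Qed.

Lemma inner_suml I (r : seq I) (P : pred I) (F : I -> R -> R[i]) h :
  (forall i, P i -> L2 (F i)) -> L2 h ->
  inner (fun x => \sum_(i <- r | P i) F i x) h = \sum_(i <- r | P i) inner (F i) h.
Proof.
move=> FL hL; elim: r => [|i r IH].
  by under eq_fun do rewrite big_nil; rewrite big_nil inner0l.
under eq_fun do rewrite big_cons; rewrite big_cons.
have [Pi|//] := boolP (P i); rewrite innerDl ?IH//; [exact: FL|exact: L2_sum].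
Qed.

Lemma innerZr c f h : L2 f -> L2 h -> inner h (fun x => c * f x) = conjc c * inner h f.
Proof.
move=> fL hL; rewrite inner_conj ?innerZl//; last exact: L2Z.
by rewrite conjcM -!inner_conj.
Qed.

Lemma inner_sumr I (r : seq I) (P : pred I) (F : I -> R -> R[i]) h :
  (forall i, P i -> L2 (F i)) -> L2 h ->
  inner h (fun x => \sum_(i <- r | P i) F i x) = \sum_(i <- r | P i) inner h (F i).
Proof.
move=> FL hL; rewrite inner_conj ?inner_suml//; last exact: L2_sum.
by rewrite conjc_sum; apply: eq_bigr => i Pi; rewrite -inner_conj//; exact: FL.
Qed.

Lemma inner_norm2 f : inner f f = (norm2 f)%:C%C.
Proof.
apply: complexP; rewrite ?Re_inner ?Im_inner/=.
  by apply: Rint_ext => x _; rewrite conjcK_mul.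
by rewrite -[RHS](Rint_cst 0); apply: Rint_ext => x _; rewrite conjcK_mul.
Qed.

Lemma norm2_ge0 f : 0 <= norm2 f.
Proof. by apply: Rintegral_ge0 => x _; apply: cabs2_ge0. Qed.

Lemma norm2D f g : L2 f -> L2 g ->
  norm2 (fun x => f x + g x) = norm2 f + norm2 g + 2 * complex.Re (inner f g).
Proof.
move=> fL gL; have [i1 i2] := integrableI0_inner fL gL.
have if_ := L2_int fL; have ig := L2_int gL.
rewrite Re_inner !norm2E -RintZ// -RintD// -RintD; [|exact: integrableI0D|exact: integrableI0Z].
by apply: Rint_ext => x _; rewrite /cabs2 !ReImE; ring.
Qed.

Lemma norm2N f : norm2 (fun x => - f x) = norm2 f.
Proof. by apply: Rint_ext => x _; exact: cabs2N. Qed.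

Lemma norm2B f g : L2 f -> L2 g ->
  norm2 (fun x => f x - g x) = norm2 f + norm2 g - 2 * complex.Re (inner f g).
Proof.
move=> fL gL; rewrite norm2D ?norm2N//; last exact: L2N.
rewrite inner_conj//; last exact: L2N.
by rewrite innerNl// Re_conjc Re_opp [inner g f]inner_conj// Re_conjc mulrN.
Qed.

Lemma norm2D_le t f g : 0 < t -> L2 f -> L2 g ->
  norm2 (fun x => f x + g x) <= (1 + t) * norm2 f + (1 + t^-1) * norm2 g.
Proof.
move=> t0 fL gL; have := L2_int fL; have := L2_int gL => ig if_.
rewrite !norm2E -!RintZ// -RintD; [|exact: integrableI0Z|exact: integrableI0Z].
apply: Rint_le => [|| x _]; [exact: L2_int (L2D _ _)| |exact: cabs2D_le].
by apply: integrableI0D; exact: integrableI0Z.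
Qed.

Lemma norm2D_le2 f g : L2 f -> L2 g ->
  norm2 (fun x => f x + g x) <= 2 * norm2 f + 2 * norm2 g.
Proof. by move=> fL gL; have := norm2D_le ltr01 fL gL; rewrite invr1. Qed.

Lemma norm2B_le2 f g : L2 f -> L2 g ->
  norm2 (fun x => f x - g x) <= 2 * norm2 f + 2 * norm2 g.
Proof. by move=> fL gL; rewrite -(norm2N g); apply: norm2D_le2 => //; apply: L2N. Qed.

Lemma norm2_bmul m f (M : R) : cmeas m -> (forall x, I0 x -> cabs2 (m x) <= M) ->
  L2 f -> norm2 (fun x => m x * f x) <= M * norm2 f.
Proof.
move=> mm mM fL; rewrite !norm2E -RintZ; last exact: L2_int.
apply: Rint_le => [||x Ix]; [exact: L2_int (L2_bmul mm mM fL)|exact: integrableI0Z (L2_int _)|].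
by rewrite cabs2M ler_wpM2r ?cabs2_ge0// mM.
Qed.

Lemma norm2_0 : norm2 (fun=> 0 : R[i]) = 0.
Proof. by rewrite norm2E cabs2_0 Rint_cst. Qed.

End L2space.

(** * Integrals of powers of the cosine *)

Section CosPowers.
Variable R : realType.
Notation mu := (@lebesgue_measure R).
Notation I0 := (@I0 R).
Notation "'\I' u" := (Rintegral mu I0 u) (at level 10, u at level 9).
Implicit Types (u F f : R -> R).

(** The offset 3 gives [rn 0 = 1/6], so every interval [Kn n] is nondegenerate, yet stays away from
    the endpoints, where negative powers of the cosine blow up. *)
Definition rn (n : nat) : R := 1/2 - n.+3%:R^-1.
Definition Kn (n : nat) : set R := `[- rn n, rn n].

Lemma rn_gt0 n : 0 < rn n.
Proof.
rewrite /rn subr_gt0 div1r ltf_pV2 ?posrE// ?ltr0n// ltr_nat//.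
Qed.

Lemma rn_lt n : rn n < 1/2.
Proof. by rewrite /rn ltrBlDr ltrDl invr_gt0. Qed.

Lemma rn_cvg : rn n @[n --> \oo] --> (1/2 : R).
Proof.
rewrite -[X in _ --> X]subr0; apply: cvgB; first exact: cvg_cst.
have := @cvg_harmonic R; rewrite -(cvg_shiftn 2).
by under eq_fun do rewrite /harmonic/= addn2.
Qed.

Lemma KnP n x : Kn n x -> - (1/2) < x < 1/2.
Proof.
rewrite /Kn/= in_itv/= => /andP[a b]; have h := rn_lt n; apply/andP; split; lra.
Qed.

Lemma Kn_sub n : Kn n `<=` I0.
Proof. by move=> x /KnP h; rewrite /I0/= in_itv/=; lra. Qed.

Lemma bigcup_Kn : \bigcup_n Kn n = `]- (1/2), 1/2[%classic.
Proof.
apply/seteqP; split => [x [n _ /KnP]|x]; rewrite /= in_itv//= => /andP[a b].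
have e0 : 0 < 1/2 - `|x| by rewrite subr_gt0 ltr_norml; apply/andP; split; lra.
have := rn_cvg => /cvgrPdist_lt /(_ _ e0)[N _ /(_ N (leqnn N))] => /= h.
exists N => //; rewrite /Kn/= in_itv/= -ler_norml.
have := ler_norm (1/2 - rn N); lra.
Qed.

Lemma Kn_nd : nondecreasing_seq Kn.
Proof.
move=> n m nm; apply/subsetPset => x; rewrite /Kn/= !in_itv/= => /andP[a b].
have : rn n <= rn m.
  by rewrite /rn lerB// lef_pV2 ?posrE// ler_nat.
by move=> h; apply/andP; split; lra.
Qed.

Lemma measurable_Kn n : measurable (Kn n).
Proof. exact: measurable_itv. Qed.
Hint Resolve measurable_Kn : core.

Lemma measurable_KnL n : @measurable _ (measurableTypeR R) (Kn n).
Proof. exact: measurable_itv. Qed.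
Hint Resolve measurable_KnL : core.

Lemma integral_Kn_cvg u : measurable_fun I0 u -> (forall x, I0 x -> 0 <= u x) ->
  (\int[mu]_(x in Kn n) (u x)%:E)%E @[n --> \oo] --> (\int[mu]_(x in I0) (u x)%:E)%E.
Proof.
move=> mu_ u0.
have -> : (\int[mu]_(x in I0) (u x)%:E = \int[mu]_(x in \bigcup_n Kn n) (u x)%:E)%E.
  rewrite bigcup_Kn; apply: integral_itv_bndoo.
  apply/measurable_EFinP; apply: measurable_funS mu_ => //; first exact: measurable_I0.
  by move=> x; rewrite /I0/= !in_itv/=; lra.
apply: ge0_nondecreasing_set_cvg_integral => //.
- exact: Kn_nd.
- move=> n; apply/measurable_EFinP; apply: measurable_funS mu_ => //.
    exact: measurable_I0.
  exact: (@Kn_sub n).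
- by move=> n x /(@Kn_sub n) Ix; rewrite lee_fin u0.
Qed.

Lemma integrableI0_of_bound u (M : R) : measurable_fun I0 u -> (forall x, I0 x -> 0 <= u x) ->
  (forall n, (\int[mu]_(x in Kn n) (u x)%:E <= M%:E)%E) -> integrableI0 u.
Proof.
move=> mu_ u0 h; apply/integrableP; split; first exact/measurable_EFinP.
apply: (@le_lt_trans _ _ M%:E); last exact: ltry.
rewrite [leLHS](_ : _ = \int[mu]_(x in I0) (u x)%:E)%E; last first.
  apply: eq_integral.
  by move=> x /set_mem Ix /=; rewrite ger0_norm// u0.
have c := integral_Kn_cvg mu_ u0.
rewrite -(cvg_lim _ c)//; apply: lime_le; first by apply/cvg_ex; eexists; exact: c.
exact: nearW.
Qed.

(** Monotone convergence handles nonnegative functions; the general case follows from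
    [u = (|u| + u) - |u|]. *)
Lemma Rint_Kn_cvg u : integrableI0 u -> Rintegral mu (Kn n) u @[n --> \oo] --> \I u.
Proof.
move=> iu.
have pos v : integrableI0 v -> (forall x, I0 x -> 0 <= v x) ->
    Rintegral mu (Kn n) v @[n --> \oo] --> \I v.
  move=> iv v0; apply: fine_cvg; rewrite fineK.
    by apply: integral_Kn_cvg => //; exact: integrableI0_meas.
  by apply: integrable_fin_num iv; exact: measurable_I0.
have iau : integrableI0 (fun x => `|u x|).
  apply: (integrableI0_le _ _ _ (v := fun x => `|u x|)); last 2 first.
  - by move=> x _; rewrite normr_id.
  - by have /integrable_abse := iu; apply: eq_integrable => //; exact: measurable_I0.
  by apply: measurableT_comp => //; exact: integrableI0_meas.
have h1 := pos _ iau (fun x _ => normr_ge0 (u x)).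
have h2 : Rintegral mu (Kn n) (fun x => `|u x| + u x) @[n --> \oo] -->
    \I (fun x => `|u x| + u x).
  apply: pos; first exact: integrableI0D.
  by move=> x _; rewrite -lerBlDl sub0r lerNl -normrN ler_norm.
have iK v n : integrableI0 v -> mu.-integrable (Kn n) (EFin \o v).
  exact: (integrableS (@measurable_I0L R) (measurable_KnL n) (@Kn_sub n)).
have e n : (Rintegral mu (Kn n) (fun x => `|u x| + u x) -
    Rintegral mu (Kn n) (fun x => `|u x|) = Rintegral mu (Kn n) u).
  by rewrite RintegralD ?iK// addrAC subrr add0r.
rewrite (_ : \I u = \I (fun x => `|u x| + u x) - \I (fun x => `|u x|)).
  by under eq_fun do rewrite -e; exact: cvgB.
by rewrite RintD// addrAC subrr add0r.
Qed.

(** The endpoints are left out because [cospow s] may be singular there; continuity of [f] is what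
    the fundamental theorem of calculus asks for on each [Kn n]. *)
Definition primitive_oo F f := forall x : R, - (1/2) < x < 1/2 ->
  is_derive x 1 F (f x) /\ {for x, continuous f}.

Lemma primitive_oo_within F f n : primitive_oo F f -> {within Kn n, continuous f}.
Proof.
move=> sm; apply: continuous_in_subspaceT => x /set_mem/KnP h.
by have [] := sm _ h.
Qed.

Lemma FTC_Kn F f n : primitive_oo F f ->
  (\int[mu]_(x in Kn n) (f x)%:E = (F (rn n) - F (- rn n))%:E)%E.
Proof.
move=> sm; have r0 := rn_gt0 n; have r1 := rn_lt n.
have dF x : - (1/2) < x < 1/2 -> {for x, continuous F}.
  move=> h; have [[d _] _] := sm _ h.
  by apply/differentiable_continuous/derivable1_diffP.
rewrite EFinB; apply: continuous_FTC2.
- lra.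
- exact: (primitive_oo_within sm).
- split.
  + move=> x; rewrite in_itv/= => /andP[a b].
    by have [[]] := sm x (ltac:(apply/andP; split; lra)).
  + by apply: cvg_at_right_filter; apply: dF; apply/andP; split; lra.
  + by apply: cvg_at_left_filter; apply: dF; apply/andP; split; lra.
- move=> x; rewrite in_itv/= => /andP[a b].
  have [d _] := sm x (ltac:(apply/andP; split; lra)).
  by rewrite derive1E; apply: derive_val.
Qed.

Lemma FTC_open F f (l1 l2 : R) : primitive_oo F f -> integrableI0 f ->
  F (rn n) @[n --> \oo] --> l1 -> F (- rn n) @[n --> \oo] --> l2 ->
  \I f = l1 - l2.
Proof.
move=> sm iF h1 h2; have c := Rint_Kn_cvg iF.
have c' : Rintegral mu (Kn n) f @[n --> \oo] --> l1 - l2.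
  by under eq_fun do rewrite /Rintegral (FTC_Kn _ sm)/=; exact: cvgB.
by apply: (cvg_unique _ c c').
Qed.

(** Integrability test for functions unbounded near the endpoints: the increments of a primitive of
    a majorant bound the integrals over all [Kn n]. *)
Lemma integrableI0_dom u F f (M : R) : measurable_fun I0 u -> (forall x, I0 x -> 0 <= u x) ->
  primitive_oo F f -> (forall x, - (1/2) < x < 1/2 -> u x <= f x) ->
  (forall n, F (rn n) - F (- rn n) <= M) -> integrableI0 u.
Proof.
move=> mu_ u0 sm uf hM; apply: (integrableI0_of_bound (M := M)) => // n.
apply: (@le_trans _ _ (\int[mu]_(x in Kn n) (f x)%:E)%E); last first.
  by rewrite (FTC_Kn _ sm) lee_fin.
apply: ge0_le_integral => //.
- by move=> x /(@Kn_sub n)/u0; rewrite lee_fin.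
- apply/measurable_EFinP; apply: measurable_funS mu_ => //; first exact: measurable_I0.
  exact: (@Kn_sub n).
- apply/measurable_EFinP; apply: subspace_continuous_measurable_fun => //.
  exact: (primitive_oo_within sm).
- by move=> x /KnP h; rewrite lee_fin uf.
Qed.

(** * Powers of the cosine: integrability and the reduction formula *)

Definition cospow (s x : R) : R := cos (pi * x) `^ s.

Lemma cos_pix_gt0 (x : R) : - (1/2) < x < 1/2 -> 0 < cos (pi * x).
Proof.
move=> /andP[a b]; apply: cos_gt0_pihalf; have := pi_gt0 R => p.
by apply/andP; split; nra.
Qed.

Lemma cos_pix_ge0 (x : R) : I0 x -> 0 <= cos (pi * x).
Proof.
rewrite /I0/= in_itv/= => /andP[a b]; apply: cos_ge0_pihalf; have := pi_gt0 R => p.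
by apply/andP; split; nra.
Qed.

Lemma is_derive_scale (c x : R) : is_derive x 1 (fun y : R => c * y) c.
Proof.
have := @is_deriveZ _ _ _ id c x 1 1 (is_derive_id _ _).
by move=> h; apply: is_derive_eq h _; rewrite /GRing.scale/= mulr1.
Qed.

Lemma is_derive_cosM (c x : R) :
  is_derive x 1 (fun y : R => cos (c * y)) (- (c * sin (c * x))).
Proof.
have h := is_derive1_comp (is_derive_cos (c * x)) (is_derive_scale c x).
apply: (is_derive_eq h).
by rewrite mulNr mulrC.
Qed.

Lemma is_derive_sinM (c x : R) :
  is_derive x 1 (fun y : R => sin (c * y)) (c * cos (c * x)).
Proof.
have h := is_derive1_comp (is_derive_sin (c * x)) (is_derive_scale c x).
apply: (is_derive_eq h).
by rewrite mulrC.
Qed.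

Lemma is_derive_cospow (s x : R) : - (1/2) < x < 1/2 ->
  is_derive x 1 (cospow s) (- (s * pi * cospow (s - 1) x * sin (pi * x))).
Proof.
move=> h; apply: is_derive_eq.
  apply: (is_derive1_comp (f := fun y => y `^ s) _ (is_derive_cosM pi x)).
  exact: is_derive1_powR (cos_pix_gt0 h).
by rewrite /cospow; ring.
Qed.

Lemma is_derive_for_continuous F (x d : R) : is_derive x 1 F d -> {for x, continuous F}.
Proof. by case=> dd _; apply/differentiable_continuous/derivable1_diffP. Qed.

Lemma cospow_continuous (s x : R) : - (1/2) < x < 1/2 -> {for x, continuous (cospow s)}.
Proof. by move=> h; exact: is_derive_for_continuous (is_derive_cospow s h). Qed.

Lemma cosM_continuous (c x : R) : {for x, continuous (fun y => cos (c * y))}.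
Proof. exact: is_derive_for_continuous (is_derive_cosM c x). Qed.

Lemma sinM_continuous (c x : R) : {for x, continuous (fun y => sin (c * y))}.
Proof. exact: is_derive_for_continuous (is_derive_sinM c x). Qed.

Lemma cospowS (s x : R) : - (1/2) < x < 1/2 -> cospow (s + 1) x = cospow s x * cos (pi * x).
Proof.
move=> h; have c0 := cos_pix_gt0 h; rewrite /cospow powRD ?(gt_eqF c0) ?implybT//.
by rewrite powRr1// ltW.
Qed.

Lemma cospow_ge0 s x : 0 <= cospow s x. Proof. exact: powR_ge0. Qed.

Lemma cospow_le1 s x : 0 <= s -> - (1/2) < x < 1/2 -> cospow s x <= 1.
Proof.
move=> s0 h; have c0 := cos_pix_gt0 h; rewrite /cospow (_ : 1 = 1 `^ s); last by rewrite powR1.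
by apply: ge0_ler_powR => //; rewrite ?nnegrE ?ltW// cos_le1.
Qed.

Lemma measurable_cosM (c : R) : measurable_fun I0 (fun y => cos (c * y)).
Proof.
apply: measurable_funTS; apply: continuous_measurable_fun => x; exact: cosM_continuous.
Qed.

Lemma measurable_sinM (c : R) : measurable_fun I0 (fun y => sin (c * y)).
Proof.
apply: measurable_funTS; apply: continuous_measurable_fun => x; exact: sinM_continuous.
Qed.

Lemma measurable_cospow s : measurable_fun I0 (cospow s).
Proof.
apply: (measurableT_comp (f := fun y => y `^ s)); first exact: measurable_powR.
exact: measurable_cosM.
Qed.

Lemma cos_rn_cvg : cos (pi * rn n) @[n --> \oo] --> (0 : R).
Proof.
rewrite -(cos_pihalf R) (_ : pi / 2 = pi * (1/2)); last by rewrite div1r.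
have := @cosM_continuous pi (1/2) => c.
exact: (cvg_comp _ _ rn_cvg c).
Qed.

Lemma cospow_rn_cvg s : 0 < s -> cospow s (rn n) @[n --> \oo] --> (0 : R).
Proof.
move=> s0; apply/cvgrPdist_lt => e e0.
have := @powR_cvg0 R s s0 => /cvgrPdist_lt /(_ _ e0)[d /= d0 hd].
have := cos_rn_cvg => /cvgrPdist_lt /(_ _ d0); apply: filterS => n /= hn.
apply: hd => //=; apply: cos_pix_gt0.
by have := rn_lt n; have := rn_gt0 n => a b; apply/andP; split; lra.
Qed.

Lemma cospow_opp s x : cospow s (- x) = cospow s x.
Proof. by rewrite /cospow mulrN cosN. Qed.

(** Replacing [sin^2] by [1 - cos^2] leaves only powers of the cosine in the derivative;
    integrability and the reduction formula both rest on it. *)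
Lemma primitive_oo_cospow_sin s : primitive_oo (fun x => sin (pi * x) * cospow (s + 1) x)
  (fun x => pi * ((s + 2) * cospow (s + 2) x - (s + 1) * cospow s x)).
Proof.
move=> x h; split.
  apply: is_derive_eq.
    exact: (is_deriveM (is_derive_sinM pi x) (is_derive_cospow (s + 1) h)).
  rewrite /GRing.scale/= addrK (_ : s + 2 = s + 1 + 1); last by ring.
  rewrite !cospowS//; have := cos2Dsin2 (pi * x).
  set c := cos _; set d := sin _; set p := cospow s x => e.
  rewrite (_ : d * _ = - ((s + 1) * pi * p * (d ^+ 2))); last by ring.
  by rewrite (_ : d ^+ 2 = 1 - c ^+ 2); [ring|rewrite -e; ring].
apply: cvgM; first exact: cvg_cst.
by apply: cvgB; apply: cvgM; try exact: cvg_cst; apply: cospow_continuous.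
Qed.

Lemma integrableI0_cospow s : -1 < s -> integrableI0 (cospow s).
Proof.
move=> s1; have s1' : 0 < s + 1 by lra.
have p0 := pi_gt0 R.
suff h : integrableI0 (fun x => (s + 1) * cospow s x).
  have /(integrableI0Z (s + 1)^-1) := h; apply: integrableI0_ext => x _.
  by rewrite mulrA mulVf ?mul1r// gt_eqF.
(* The majorant adds the nonnegative term [(s + 2) (1 - cospow (s + 2) x)] to [(s + 1) cospow s x],
   which turns it into an exact derivative. Its primitive is bounded, since
   [cospow (s + 1) <= 1]. *)
apply: (integrableI0_dom (F := fun x => (s + 2) * x - pi^-1 * (sin (pi * x) * cospow (s + 1) x))
  (f := fun x => (s + 2) - ((s + 2) * cospow (s + 2) x - (s + 1) * cospow s x))
  (M := s + 2 + 2 * pi^-1)).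
- by apply: measurable_funM => //; exact: measurable_cospow.
- by move=> x _; rewrite mulr_ge0 ?cospow_ge0// ltW.
- move=> x h; have [d c] := primitive_oo_cospow_sin s h; split.
    have d2 := @is_deriveB _ _ _ _ _ _ _ _ _ (is_derive_scale (s + 2) x) (is_deriveZ pi^-1 d).
    apply: (is_derive_eq d2); rewrite /GRing.scale/= mulrA mulVf ?mul1r//.
    by rewrite gt_eqF.
  apply: cvgB; first exact: cvg_cst.
  by apply: cvgB; apply: cvgM; try exact: cvg_cst; apply: cospow_continuous.
- move=> x h; rewrite opprB addrCA lerDl -[X in X - _]mulr1 -mulrBr.
  rewrite mulr_ge0//; first lra.
  by rewrite subr_ge0 cospow_le1//; lra.
- move=> n; have r0 := rn_gt0 n; have r1 := rn_lt n.
  have h : - (1/2) < rn n < 1/2 by apply/andP; split; lra.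
  rewrite cospow_opp (mulrN pi) sinN (mulrN (s + 2)) mulNr (mulrN pi^-1) opprK.
  have := sin_le1 (pi * rn n); have := @cospow_le1 (s + 1) _ (ltW s1') h.
  have := cospow_ge0 (s + 1) (rn n); set p := cospow _ _; set q := sin _ => a b c.
  have pq : q * p <= 1.
    by apply: (@le_trans _ _ p) => //; rewrite ler_piMl.
  have ip : 0 < pi^-1 :> R by rewrite invr_gt0.
  have : pi^-1 * (q * p) <= pi^-1 by rewrite ler_piMr// ltW.
  have q1 : -1 <= q by exact: sin_geN1.
  have : - pi^-1 <= pi^-1 * (q * p).
    rewrite -mulrN1 ler_wpM2l ?(ltW ip)//.
    by nra.
  have : (s + 2) * rn n <= (s + 2) * (1/2) by rewrite ler_wpM2l//; lra.
  lra.
Qed.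

(** The boundary terms carry [cospow (s + 1)], which tends to 0 because [s > -1]. The factor [s + 1]
    on the left measures the blow-up of the integral as [s] decreases to -1. *)
Lemma Rint_cospow_rec s : -1 < s -> (s + 1) * \I (cospow s) = (s + 2) * \I (cospow (s + 2)).
Proof.
move=> s1; have i1 := integrableI0_cospow s1.
have i2 : integrableI0 (cospow (s + 2)) by apply: integrableI0_cospow; lra.
have p0 := pi_gt0 R.
have iB : integrableI0 (fun x => (s + 2) * cospow (s + 2) x - (s + 1) * cospow s x).
  by apply: integrableI0D; [exact: integrableI0Z|apply: integrableI0N; exact: integrableI0Z].
have iF := integrableI0Z pi iB.
(* The values [e = 1] and [e = -1] serve the right and the left endpoint. *)
have lim0 (e : R) : sin (pi * (e * rn n)) * cospow (s + 1) (rn n) @[n --> \oo] --> (0 : R).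
  rewrite -(mulr0 (sin (pi * (e * (1/2))))); apply: cvgM; last first.
    by apply: cospow_rn_cvg; lra.
  have h : {for (1/2), continuous (fun y : R => sin ((pi * e) * y))}.
    exact: sinM_continuous.
  under eq_fun do rewrite mulrA; rewrite mulrA.
  exact: (cvg_comp _ _ rn_cvg h).
have := FTC_open (l1 := 0) (l2 := 0) (@primitive_oo_cospow_sin s) iF.
rewrite subrr RintZ//.
rewrite RintD ?RintN ?RintZ//; try exact: integrableI0Z; last first.
  by apply: integrableI0N; exact: integrableI0Z.
move=> H.
have /eqP : pi * ((s + 2) * \I (cospow (s + 2)) - (s + 1) * \I (cospow s)) = 0.
  apply: H.
    by have := lim0 1; under eq_fun do rewrite mul1r.
  by under eq_fun do rewrite cospow_opp; have := lim0 (-1); under eq_fun do rewrite mulN1r.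
by rewrite mulf_eq0 (gt_eqF p0) subr_eq0 => /eqP.
Qed.

(** * Trigonometric moments of the powers of the cosine *)

Lemma integrableI0_cospow_cos a b : -1 < a -> integrableI0 (fun x => cospow a x * cos (b * x)).
Proof.
move=> a1; apply: (integrableI0_le _ _ (integrableI0_cospow a1)).
  by apply: measurable_funM; [exact: measurable_cospow|exact: measurable_cosM].
move=> x _; rewrite normrM ger0_norm ?cospow_ge0// ler_piMr ?cospow_ge0// ler_norml.
by rewrite cos_le1 cos_geN1.
Qed.

Lemma integrableI0_cospow_sin a b : -1 < a -> integrableI0 (fun x => cospow a x * sin (b * x)).
Proof.
move=> a1; apply: (integrableI0_le _ _ (integrableI0_cospow a1)).
  by apply: measurable_funM; [exact: measurable_cospow|exact: measurable_sinM].
move=> x _; rewrite normrM ger0_norm ?cospow_ge0// ler_piMr ?cospow_ge0// ler_norml.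
by rewrite sin_le1 sin_geN1.
Qed.

(** Product-to-sum formulas turn the derivative of [cos (pi c x) cospow (a + 1) x] into this
    combination of the frequencies [c + 1] and [c - 1], and its boundary values vanish. *)
Lemma cospow_sin_rec a c : -1 < a ->
  (c + a + 1) * \I (fun x => cospow a x * sin (pi * (c + 1) * x)) +
  (c - a - 1) * \I (fun x => cospow a x * sin (pi * (c - 1) * x)) = 0.
Proof.
move=> a1.
have i1 := integrableI0_cospow_sin (pi * (c + 1)) a1.
have i2 := integrableI0_cospow_sin (pi * (c - 1)) a1.
have sm : primitive_oo (fun x => cos (pi * c * x) * cospow (a + 1) x)
  (fun x => - (pi / 2) * ((c + a + 1) * (cospow a x * sin (pi * (c + 1) * x)) +
     (c - a - 1) * (cospow a x * sin (pi * (c - 1) * x)))).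
  move=> x h; split.
    apply: is_derive_eq.
      exact: (is_deriveM (is_derive_cosM (pi * c) x) (is_derive_cospow (a + 1) h)).
    rewrite /GRing.scale/= addrK cospowS//.
    rewrite (_ : pi * (c + 1) * x = pi * c * x + pi * x); last by ring.
    rewrite (_ : pi * (c - 1) * x = pi * c * x - pi * x); last by ring.
    by rewrite sinD sinB; field.
  apply: cvgM; first exact: cvg_cst.
  by apply: cvgD; apply: cvgM; try exact: cvg_cst;
     apply: cvgM; first [exact: cospow_continuous|exact: sinM_continuous].
have iF : integrableI0 (fun x => (c + a + 1) * (cospow a x * sin (pi * (c + 1) * x)) +
     (c - a - 1) * (cospow a x * sin (pi * (c - 1) * x))).
  by apply: integrableI0D; exact: integrableI0Z.
have lim0 : cos (pi * c * rn n) * cospow (a + 1) (rn n) @[n --> \oo] --> (0 : R).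
  rewrite -(mulr0 (cos (pi * c * (1/2)))); apply: cvgM; last first.
    by apply: cospow_rn_cvg; lra.
  exact: (cvg_comp _ _ rn_cvg (@cosM_continuous (pi * c) (1/2))).
have := FTC_open (l1 := 0) (l2 := 0) sm (integrableI0Z _ iF) lim0.
under [in X in X -> _]eq_fun do rewrite cospow_opp mulrN cosN.
move=> /(_ lim0); rewrite subrr RintZ// RintD ?RintZ//; try exact: integrableI0Z.
move=> /eqP; rewrite mulf_eq0 oppr_eq0 => /predU1P[e|/eqP//].
by have := pi_gt0 R; lra.
Qed.

Lemma cospow_cos_rec a c : -1 < a ->
  (c + a + 1) * \I (fun x => cospow a x * cos (pi * (c + 1) * x)) +
  (c - a - 1) * \I (fun x => cospow a x * cos (pi * (c - 1) * x)) = 0.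
Proof.
move=> a1.
have i1 := integrableI0_cospow_cos (pi * (c + 1)) a1.
have i2 := integrableI0_cospow_cos (pi * (c - 1)) a1.
have sm : primitive_oo (fun x => sin (pi * c * x) * cospow (a + 1) x)
  (fun x => (pi / 2) * ((c + a + 1) * (cospow a x * cos (pi * (c + 1) * x)) +
     (c - a - 1) * (cospow a x * cos (pi * (c - 1) * x)))).
  move=> x h; split.
    apply: is_derive_eq.
      exact: (is_deriveM (is_derive_sinM (pi * c) x) (is_derive_cospow (a + 1) h)).
    rewrite /GRing.scale/= addrK cospowS//.
    rewrite (_ : pi * (c + 1) * x = pi * c * x + pi * x); last by ring.
    rewrite (_ : pi * (c - 1) * x = pi * c * x - pi * x); last by ring.
    by rewrite cosD cosB; field.
  apply: cvgM; first exact: cvg_cst.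
  by apply: cvgD; apply: cvgM; try exact: cvg_cst;
     apply: cvgM; first [exact: cospow_continuous|exact: cosM_continuous].
have iF : integrableI0 (fun x => (c + a + 1) * (cospow a x * cos (pi * (c + 1) * x)) +
     (c - a - 1) * (cospow a x * cos (pi * (c - 1) * x))).
  by apply: integrableI0D; exact: integrableI0Z.
have lim0 : sin (pi * c * rn n) * cospow (a + 1) (rn n) @[n --> \oo] --> (0 : R).
  rewrite -(mulr0 (sin (pi * c * (1/2)))); apply: cvgM; last first.
    by apply: cospow_rn_cvg; lra.
  exact: (cvg_comp _ _ rn_cvg (@sinM_continuous (pi * c) (1/2))).
have lim1 : sin (pi * c * - rn n) * cospow (a + 1) (- rn n) @[n --> \oo] --> (0 : R).
  under eq_fun do rewrite cospow_opp mulrN sinN mulNr.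
  by rewrite -oppr0; exact: cvgN.
have := FTC_open sm (integrableI0Z _ iF) lim0 lim1.
rewrite subrr RintZ// RintD ?RintZ//; try exact: integrableI0Z.
move=> /eqP; rewrite mulf_eq0 => /predU1P[e|/eqP//].
by have := pi_gt0 R; lra.
Qed.

(** At [c = a + 1] the lower frequency drops out of the recurrence, which kills the moment of
    frequency [a + 2]; each further step raises the frequency by 2. *)
Lemma Rint_cospow_cos_eq0 a (m : nat) : -1 < a ->
  \I (fun x => cospow a x * cos (pi * (a + 2 + 2 * m%:R) * x)) = 0.
Proof.
move=> a1; elim: m => [|m IH].
  have := cospow_cos_rec (a + 1) a1; rewrite (_ : a + 1 - a - 1 = 0); last by ring.
  rewrite mul0r addr0 => /eqP; rewrite mulf_eq0 => /predU1P[|/eqP]; first lra.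
  by rewrite mulr0 addr0 (_ : a + 1 + 1 = a + 2)//; ring.
have := cospow_cos_rec (a + 3 + 2 * m%:R) a1.
rewrite (_ : a + 3 + 2 * m%:R - 1 = a + 2 + 2 * m%:R); last by ring.
rewrite IH mulr0 addr0 => /eqP; rewrite mulf_eq0 => /predU1P[|/eqP].
  by have : 0 <= m%:R :> R by []; lra.
by rewrite (_ : a + 3 + 2 * m%:R + 1 = a + 2 + 2 * m.+1%:R)// -(natr1 m); ring.
Qed.

Lemma Rint_cospow_sin_eq0 a (m : nat) : -1 < a ->
  \I (fun x => cospow a x * sin (pi * (a + 2 + 2 * m%:R) * x)) = 0.
Proof.
move=> a1; elim: m => [|m IH].
  have := cospow_sin_rec (a + 1) a1; rewrite (_ : a + 1 - a - 1 = 0); last by ring.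
  rewrite mul0r addr0 => /eqP; rewrite mulf_eq0 => /predU1P[|/eqP]; first lra.
  by rewrite mulr0 addr0 (_ : a + 1 + 1 = a + 2)//; ring.
have := cospow_sin_rec (a + 3 + 2 * m%:R) a1.
rewrite (_ : a + 3 + 2 * m%:R - 1 = a + 2 + 2 * m%:R); last by ring.
rewrite IH mulr0 addr0 => /eqP; rewrite mulf_eq0 => /predU1P[|/eqP].
  by have : 0 <= m%:R :> R by []; lra.
by rewrite (_ : a + 3 + 2 * m%:R + 1 = a + 2 + 2 * m.+1%:R)// -(natr1 m); ring.
Qed.

End CosPowers.

(** * Sums over the integers *)

Section IntSums.
Variable R : realType.
Implicit Types (s t : seq int) (a : int -> R).

(** [\esum] is a supremum over finite sets of indices; listing these without repetition lets frame
    bounds be proved and used on ordinary finite sums. *)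
Lemma esum_le_seq a (M : R) : (forall s, uniq s -> \sum_(k <- s) a k <= M) ->
  (\esum_(k in [set: int]) (a k)%:E <= M%:E)%E.
Proof.
move=> h; apply: ge_ereal_sup => _ /= [X [finX _] <-].
by rewrite fsbig_finite//= sumEFin lee_fin; apply: h; exact: fset_uniq.
Qed.

Lemma seq_le_esum a s : uniq s ->
  ((\sum_(k <- s) a k)%:E <= \esum_(k in [set: int]) (a k)%:E)%E.
Proof.
move=> us; apply: esum_ge; exists [set` s]; first by split => //; exact: finite_seq.
by rewrite -sumEFin fsbig_seq.
Qed.

Lemma esum_gt_seq a (x : R) : (x%:E < \esum_(k in [set: int]) (a k)%:E)%E ->
  exists2 s, uniq s & x < \sum_(k <- s) a k.
Proof.
move=> /ereal_sup_gt[_ /= [X [finX _] <-]].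
rewrite fsbig_finite//= sumEFin lte_fin => h.
by exists (enum_fset (fset_set X)) => //; exact: fset_uniq.
Qed.

Lemma big_sub_uniq (V : nmodType) s t (F : int -> V) : uniq s -> uniq t ->
  {subset s <= t} -> \sum_(k <- t | k \in s) F k = \sum_(k <- s) F k.
Proof.
move=> us ut st; rewrite -big_filter; apply: perm_big; apply: uniq_perm => //.
  exact: filter_uniq.
move=> k; rewrite mem_filter; apply/andP/idP => [[]//|ks]; split => //; exact: st.
Qed.

Lemma ler_sum_sub s t a : uniq s -> uniq t -> {subset s <= t} ->
  (forall k, 0 <= a k) -> \sum_(k <- s) a k <= \sum_(k <- t) a k.
Proof.
move=> us ut st a0; rewrite -(big_sub_uniq _ us ut st) big_mkcond/=.
by apply: ler_sum => k _; case: ifP.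
Qed.

Definition window (N : nat) : seq int := [seq i%:Z - N%:Z | i <- iota 0 (2 * N).+1].

Lemma window_uniq N : uniq (window N).
Proof. by rewrite map_inj_uniq ?iota_uniq// => i j /addIr[]. Qed.

Lemma mem_window N (k : int) : (k \in window N) = (`|k| <= N)%N.
Proof.
apply/mapP/idP => [[i ii ->]|kN].
  by move: ii; rewrite mem_iota => /andP[_ iN]; lia.
exists (absz (k + N%:Z)); last by lia.
by rewrite mem_iota; lia.
Qed.

Lemma sub_window s : exists N, {subset s <= window N}.
Proof.
elim: s => [|k s [N IH]]; first by exists 0%N.
exists (maxn N `|k|) => j; rewrite inE mem_window => /predU1P[->|/IH].
  exact: leq_maxr.
by rewrite mem_window => h; rewrite (leq_trans h)// leq_maxl.
Qed.

Lemma window_sub N M : (N <= M)%N -> {subset window N <= window M}.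
Proof. by move=> NM k; rewrite !mem_window => /leq_trans; apply. Qed.

Lemma psumE (al : int -> R[i]) F N : psum al F N =
  (fun x => \sum_(k <- window N) al k * F k x).
Proof.
apply/funext => x; rewrite /psum /window big_map -[in RHS](subn0 (2 * N).+1).
by rewrite -/(index_iota 0 _) big_mkord.
Qed.

End IntSums.

(** * Exponentials and the Bessel inequality *)

Section Exponentials.
Variable R : realType.
Notation mu := (@lebesgue_measure R).
Notation I0 := (@I0 R).
Notation "'\I' u" := (Rintegral mu I0 u) (at level 10, u at level 9).
Notation E := (@cexp2pi R).
Notation e := (fun k : int => @cexp2pi R k%:~R).
Implicit Types (f g : R -> R[i]) (s : seq int) (a : int -> R[i]).

Lemma cexpD (p q x : R) : E (p + q) x = E p x * E q x.
Proof.
apply: complexP; rewrite ReImE/=;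
  rewrite (_ : 2 * pi * (p + q) * x = 2 * pi * p * x + 2 * pi * q * x); try ring.
  by rewrite cosD.
by rewrite sinD; ring.
Qed.

Lemma cexp_conj (p x : R) : conjc (E p x) = E (- p) x.
Proof. by apply: complexP; rewrite /= mulrN mulNr ?cosN ?sinN. Qed.

Lemma cexp0 (x : R) : E 0 x = 1.
Proof. by apply: complexP; rewrite /= mulr0 mul0r ?cos0 ?sin0. Qed.

Lemma cabs2_cexp (p x : R) : cabs2 (E p x) = 1.
Proof. by rewrite /cabs2/= cos2Dsin2. Qed.

Lemma cmeas_cexp (p : R) : cmeas (E p).
Proof. by split; [exact: measurable_cosM|exact: measurable_sinM]. Qed.

Lemma L2_cexp (p : R) : L2 (E p).
Proof.
by apply: (L2_bound (M := 1) (cmeas_cexp p)) => x _; rewrite cabs2_cexp.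
Qed.
Hint Resolve L2_cexp : core.

Lemma L2_cexpM (p : R) f : L2 f -> L2 (fun x => E p x * f x).
Proof. by apply: (L2_bmul (M := 1) (cmeas_cexp p)) => x _; rewrite cabs2_cexp. Qed.

Lemma inner_cexpM (p q : R) f : inner (fun x => E p x * f x) (E q) = inner f (E (q - p)).
Proof.
congr Complex; apply: Rint_ext => x _; congr (_ _);
  by rewrite !cexp_conj opprB cexpD; ring.
Qed.

Lemma norm2_cexpM (p : R) f : norm2 (fun x => E p x * f x) = norm2 f.
Proof. by apply: Rint_ext => x _; have := cabs2M (E p x) (f x); rewrite cabs2_cexp mul1r. Qed.

(** This is the case [a = 0] of the cosine moments: [cospow 0] is 1 and the frequencies
    [a + 2 + 2 m] are the even numbers [2 (m + 1)]. *)
Lemma Rint_cos (n : int) : \I (fun x => cos (2 * pi * n%:~R * x)) = (n == 0)%:R.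
Proof.
have [->|n0] := eqVneq n 0.
  rewrite -[RHS](Rint_cst 1); apply: Rint_ext => x _.
  by rewrite mulr0 mul0r cos0.
have pos (m : nat) : \I (fun x => cos (2 * pi * m.+1%:R * x)) = 0.
  rewrite -(@Rint_cospow_cos_eq0 R 0 m); last by lra.
  apply: Rint_ext => x _; rewrite /cospow powRr0 mul1r; congr cos.
  by rewrite -natr1; ring.
case: n n0 => [[//|m] _|m _]; first exact: pos.
rewrite -[RHS](pos m); apply: Rint_ext => x _.
by rewrite NegzE rmorphN/= mulrN mulNr cosN.
Qed.

Lemma Rint_sin (n : int) : \I (fun x => sin (2 * pi * n%:~R * x)) = 0.
Proof.
have pos (m : nat) : \I (fun x => sin (2 * pi * m%:R * x)) = 0.
  case: m => [|m].
    by rewrite -[RHS](Rint_cst 0); apply: Rint_ext => x _; rewrite mulr0 mul0r sin0.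
  rewrite -(@Rint_cospow_sin_eq0 R 0 m); last by lra.
  apply: Rint_ext => x _; rewrite /cospow powRr0 mul1r; congr sin.
  by rewrite -natr1; ring.
case: n => m; first exact: pos.
rewrite -[RHS]oppr0 -(pos m.+1) -RintN.
  by apply: Rint_ext => x _; rewrite NegzE rmorphN/= mulrN mulNr sinN.
have := @integrableI0_cospow_sin R 0 (2 * pi * m.+1%:R) ltac:(lra).
by apply: integrableI0_ext => x _; rewrite /cospow powRr0 mul1r.
Qed.

Lemma inner_cexp (j k : int) : inner (e j) (e k) = (j == k)%:R.
Proof.
have h x : e j x * conjc (e k x) = E (j - k)%:~R x.
  by rewrite cexp_conj -cexpD rmorphB.
rewrite -(subr_eq0 j k); apply: complexP.
  rewrite Re_inner; under Rint_ext => x _ do rewrite h/=.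
  by rewrite Rint_cos; case: (_ == _).
rewrite Im_inner; under Rint_ext => x _ do rewrite h/=.
by rewrite Rint_sin; case: (_ == _).
Qed.

Definition trigp s a : R -> R[i] := fun x => \sum_(k <- s) a k * e k x.

Lemma L2_trigp s a : L2 (trigp s a).
Proof. by apply: L2_sum => k _; apply: L2Z. Qed.
Hint Resolve L2_trigp : core.

Lemma inner_trigpr s a f : L2 f -> inner f (trigp s a) = \sum_(k <- s) conjc (a k) * inner f (e k).
Proof.
move=> fL; rewrite inner_sumr//; last by move=> k _; apply: L2Z.
by apply: eq_bigr => k _; rewrite innerZr.
Qed.

Lemma inner_trigpl s a k : uniq s -> inner (trigp s a) (e k) = if k \in s then a k else 0.
Proof.
move=> us; rewrite inner_suml//; last by move=> j _; apply: L2Z.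
transitivity (\sum_(j <- s | j == k) a j).
  rewrite [RHS]big_mkcond; apply: eq_bigr => j _; rewrite innerZl// inner_cexp.
  by case: eqP; rewrite ?mulr1 ?mulr0.
case: ifPn => ks.
  rewrite (big_rem k)//= eqxx big1_seq ?addr0// => j /andP[/eqP->].
  by rewrite mem_rem_uniq// inE eqxx.
by rewrite big1_seq// => j /andP[/eqP-> ks']; rewrite ks' in ks.
Qed.

Lemma norm2_trigp s a : uniq s -> norm2 (trigp s a) = \sum_(k <- s) cabs2 (a k).
Proof.
move=> us; rewrite -[LHS]ReC -inner_norm2.
rewrite inner_trigpr// Re_sum !big_seq; apply: eq_bigr => k ks.
by rewrite inner_trigpl// ks mulrC conjcK_mul.
Qed.

(** Completing the square. The last sum vanishes at the Fourier coefficients, which gives Bessel's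
    inequality; dropping it gives the optimality of these coefficients. *)
Lemma norm2_sub_trigp s a f : uniq s -> L2 f ->
  norm2 (fun x => f x - trigp s a x) = norm2 f - \sum_(k <- s) cabs2 (inner f (e k)) +
    \sum_(k <- s) cabs2 (a k - inner f (e k)).
Proof.
move=> us fL; rewrite norm2B// norm2_trigp// inner_trigpr// Re_sum.
rewrite -!addrA; congr (_ + _); rewrite mulr_sumr -!sumrN -!big_split/=.
by apply: eq_bigr => k _; rewrite /cabs2 !ReImE; ring.
Qed.

Lemma bessel s f : uniq s -> L2 f -> \sum_(k <- s) cabs2 (inner f (e k)) <= norm2 f.
Proof.
move=> us fL; have := norm2_ge0 (fun x => f x - trigp s (fun k => inner f (e k)) x).
rewrite norm2_sub_trigp// [X in _ + X]big1 ?addr0 ?subr_ge0// => k _.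
by rewrite subrr cabs2_0.
Qed.

Lemma norm2_sub_trigp_ge s a f : uniq s -> L2 f ->
  norm2 f - \sum_(k <- s) cabs2 (inner f (e k)) <= norm2 (fun x => f x - trigp s a x).
Proof.
move=> us fL; rewrite norm2_sub_trigp// lerDl; apply: sumr_ge0 => k _; exact: cabs2_ge0.
Qed.

Definition tspan f := exists s a, uniq s /\ f = trigp s a.

Lemma tspanD f g : tspan f -> tspan g -> tspan (fun x => f x + g x).
Proof.
move=> [s [a [us ->]]] [t [b [ut ->]]].
exists (undup (s ++ t)), (fun k => (if k \in s then a k else 0) + (if k \in t then b k else 0)).
split; first exact: undup_uniq.
apply/funext => x; rewrite /trigp; under [RHS]eq_bigr do rewrite mulrDl.
rewrite big_split/=; congr (_ + _).
  rewrite -(big_sub_uniq _ us (undup_uniq (s ++ t))).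
    by rewrite big_mkcond; apply: eq_bigr => k _; case: ifP; rewrite ?mul0r.
  by move=> k ks; rewrite mem_undup mem_cat ks.
rewrite -(big_sub_uniq _ ut (undup_uniq (s ++ t))).
  by rewrite big_mkcond; apply: eq_bigr => k _; case: ifP; rewrite ?mul0r.
by move=> k ks; rewrite mem_undup mem_cat ks orbT.
Qed.

Lemma tspanZ c f : tspan f -> tspan (fun x => c * f x).
Proof.
move=> [s [a [us ->]]]; exists s, (fun k => c * a k); split => //.
by apply/funext => x; rewrite /trigp mulr_sumr; apply: eq_bigr => k _; rewrite mulrA.
Qed.

Lemma tspan_cexpM (j : int) f : tspan f -> tspan (fun x => e j x * f x).
Proof.
move=> [s [a [us ->]]]; exists [seq k + j | k <- s], (fun k => a (k - j)); split.
  by rewrite map_inj_uniq//; exact: addIr.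
apply/funext => x; rewrite /trigp mulr_sumr big_map; apply: eq_bigr => k _.
by rewrite addrK rmorphD/= cexpD; ring.
Qed.

Lemma tspan_cexp (j : int) : tspan (e j).
Proof.
exists [:: j], (fun=> 1); split => //.
by apply/funext => x; rewrite /trigp big_seq1 mul1r.
Qed.

Lemma tspan0 : tspan (fun=> 0).
Proof. by exists [::], (fun=> 0); split => //; apply/funext => x; rewrite /trigp big_nil. Qed.

Lemma L2_tspan f : tspan f -> L2 f.
Proof. by move=> [s [a [_ ->]]]. Qed.

End Exponentials.

(** * Parseval identity *)

Section StepLimit.
Variable R : realType.

Lemma bernoulli_ge (y : R) m : -1 <= y -> 1 + m%:R * y <= (1 + y) ^+ m.
Proof.
move=> y1; elim: m => [|m IH]; first by rewrite expr0 mul0r addr0.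
have y0 : 0 <= 1 + y by lra.
rewrite exprS; apply: (@le_trans _ _ ((1 + y) * (1 + m%:R * y))); last exact: ler_wpM2l.
have : 0 <= m%:R * y ^+ 2 by rewrite mulr_ge0// sqr_ge0.
by rewrite -natr1; lra.
Qed.

(** Multiply [bernoulli_ge] by [(1 - y)^m] and use [(1 - y^2)^m <= 1]. *)
Lemma bernoulli_le (y : R) m : 0 <= y <= 1 -> (1 - y) ^+ m * (1 + m%:R * y) <= 1.
Proof.
move=> /andP[y0 y1].
have h1 : 1 + m%:R * y <= (1 + y) ^+ m by apply: bernoulli_ge; lra.
apply: (@le_trans _ _ ((1 - y) ^+ m * (1 + y) ^+ m)).
  by rewrite ler_wpM2l// exprn_ge0//; lra.
rewrite -exprMn exprn_ile1//; nra.
Qed.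

Lemma cvg_natM_expr (q : R) : 0 <= q < 1 -> n%:R * q ^+ n @[n --> \oo] --> (0 : R).
Proof.
move=> /andP[]; rewrite le_eqVlt => /predU1P[<- _|q0 q1].
  rewrite (_ : (fun n : nat => _) = fun=> 0); first exact: cvg_cst.
  by apply/funext => -[|n]; rewrite ?mul0r// exprS mul0r mulr0.
(* In [q ^ n = r ^ n * r ^ n], Bernoulli's inequality for [1 / r = 1 + h] bounds [n r ^ n] by
   [1 / h], and the other factor tends to 0. *)
pose r := Num.sqrt q.
have r0 : 0 < r by rewrite sqrtr_gt0.
have r2 : r ^+ 2 = q by rewrite sqr_sqrtr// ltW.
have r1 : r < 1 by rewrite -(ltr_pXn2r (n := 2)) ?nnegrE ?(ltW r0)// r2 expr1n.
pose h := r^-1 - 1.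
have h0 : 0 < h by rewrite subr_gt0 invf_gt1.
have bd n : n%:R * r ^+ n <= h^-1.
  have := @bernoulli_ge h n ltac:(lra).
  have -> : 1 + h = r^-1 by rewrite /h; ring.
  rewrite exprVn => le.
  have rn0 : 0 < r ^+ n by rewrite exprn_gt0.
  rewrite -ler_pdivlMr// mulrC -ler_pdivrMr ?invr_gt0// invrK.
  by apply: le_trans le; rewrite lerDr.
apply: (@squeeze_cvgr _ _ _ _ (fun=> 0) (fun n => h^-1 * r ^+ n)).
- near=> n; apply/andP; split; first by rewrite mulr_ge0// exprn_ge0// ltW.
  rewrite -r2 -exprM mulnC mulnS muln1 exprD mulrA ler_wpM2r//.
  by rewrite exprn_ge0// ltW.
- exact: cvg_cst.
- rewrite -(mulr0 h^-1); apply: cvgM; first exact: cvg_cst.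
  by apply: cvg_expr; rewrite ger0_norm// ltW.
Unshelve. all: by end_near.
Qed.

(* The factor [n] in the exponent [n 2^n] makes the limit vanish at [t = 0] too. *)
Definition stepn (n : nat) (t : R) : R := (1 - ((1 - t) / 2) ^+ n) ^+ (n * 2 ^ n).

Lemma stepn_bound n t : -1 <= t <= 1 -> 0 <= stepn n t <= 1.
Proof.
move=> /andP[t0 t1]; have s0 : 0 <= (1 - t) / 2 by lra.
have s1 : (1 - t) / 2 <= 1 by lra.
have y0 := exprn_ge0 n s0; have y1 := exprn_ile1 n s0 s1.
by rewrite /stepn exprn_ge0 ?exprn_ile1//; lra.
Qed.

(** With [s = (1 - t) / 2], Bernoulli's inequalities compare [stepn n t] with
    [n 2^n s^n = n (2 s)^n]. This tends to 0 when [t > 0], that is [2 s < 1], and is at least [n]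
    otherwise. Such polynomials are familiar from elementary proofs of the Stone-Weierstrass
    theorem. *)
Lemma stepn_cvg t : -1 <= t <= 1 -> stepn n t @[n --> \oo] --> ((0 < t)%R%:R : R).
Proof.
move=> t11; have /andP[t0 t1] := t11; set s := (1 - t) / 2.
have s0 : 0 <= s by rewrite /s; lra.
have s1 : s <= 1 by rewrite /s; lra.
have my n : (n * 2 ^ n)%N%:R * s ^+ n = n%:R * (2 * s) ^+ n.
  by rewrite natrM natrX -mulrA -exprMn.
have yb n : 0 <= s ^+ n <= 1 by rewrite exprn_ge0// exprn_ile1.
case: ltP => trigp.
- apply: (@squeeze_cvgr _ _ _ _ (fun n => 1 - n%:R * (2 * s) ^+ n) (fun=> 1)).
  + near=> n; have /andP[_ ->] := stepn_bound n t11; rewrite andbT.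
    rewrite -my -mulrN /stepn -/s; apply: bernoulli_ge.
    by have := yb n; lra.
  + rewrite -[X in _ --> X]subr0; apply: cvgB; first exact: cvg_cst.
    by apply: cvg_natM_expr; rewrite /s; lra.
  + exact: cvg_cst.
- apply: (@squeeze_cvgr _ _ _ _ (fun=> 0) (fun n => n.+1%:R^-1)).
  + near=> n; have /andP[-> _] := stepn_bound n t11 => /=.
    have := bernoulli_le (n * 2 ^ n) (yb n); rewrite my -/(stepn n t).
    have h : 1 <= (2 * s) ^+ n by rewrite exprn_ege1// /s; lra.
    have h2 : n.+1%:R <= 1 + n%:R * (2 * s) ^+ n.
      by rewrite -natr1 addrC lerD2l ler_peMr.
    rewrite -[_ <= n.+1%:R^-1](ler_pM2r (x := n.+1%:R))// mulVf//.
    apply: le_trans; rewrite ler_wpM2l//.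
    by have /andP[] := stepn_bound n t11.
  + exact: cvg_cst.
  + exact: cvg_harmonic.
Unshelve. all: by end_near.
Qed.

End StepLimit.

(** * Density of the trigonometric polynomials in L2 *)

Section Density.
Variable R : realType.
Notation mu := (@lebesgue_measure R).
Notation I0 := (@I0 R).
Notation "'\I' u" := (Rintegral mu I0 u) (at level 10, u at level 9).
Notation E := (@cexp2pi R).
Notation e := (fun k : int => @cexp2pi R k%:~R).
Implicit Types (f g : R -> R[i]) (u v w h : R -> R).

Definition tclos f := L2 f /\
  forall eps : R, 0 < eps -> exists2 p, tspan p & norm2 (fun x => f x - p x) < eps.

Lemma tclos_L2 f : tclos f -> L2 f. Proof. by case. Qed.

Lemma tclos_span f : tspan f -> tclos f.
Proof.
move=> tf; split; first exact: L2_tspan.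
move=> eps e0; exists f => //; under eq_fun do rewrite subrr.
by rewrite norm2_0.
Qed.

Lemma tclos_closed f : L2 f ->
  (forall eps : R, 0 < eps -> exists2 g, tclos g & norm2 (fun x => f x - g x) < eps) ->
  tclos f.
Proof.
move=> fL h; split => // eps e0.
have e4 : 0 < eps / 4 by rewrite divr_gt0.
have [g [gL gc] fg] := h _ e4; have [p trigp gp] := gc _ e4.
exists p => //; have pL := L2_tspan trigp.
have := norm2D_le2 (L2B fL gL) (L2B gL pL).
by under eq_fun do rewrite addrA subrK; lra.
Qed.

Lemma tclosD f g : tclos f -> tclos g -> tclos (fun x => f x + g x).
Proof.
move=> [fL fc] [gL gc]; split; first exact: L2D.
move=> eps e0; have e4 : 0 < eps / 4 by rewrite divr_gt0.
have [p trigp fp] := fc _ e4; have [q tq gq] := gc _ e4.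
exists (fun x => p x + q x); first exact: tspanD.
have := norm2D_le2 (L2B fL (L2_tspan trigp)) (L2B gL (L2_tspan tq)).
by under eq_fun do rewrite addrACA -opprD; lra.
Qed.

Lemma tclos_bmul (m : R -> R[i]) (M : R) f : cmeas m ->
  (forall x, I0 x -> cabs2 (m x) <= M) ->
  (forall p, tspan p -> tclos (fun x => m x * p x)) ->
  tclos f -> tclos (fun x => m x * f x).
Proof.
move=> mm mM h [fL fc]; apply: tclos_closed; first exact: (L2_bmul mm mM).
(* [|M| + 1] is still a bound and can be divided by, even when [M = 0]. *)
move=> eps e0; have M0 : 0 < `|M| + 1 by rewrite ltr_pwDr.
have [p trigp fp] := fc _ (divr_gt0 e0 M0).
exists (fun x => m x * p x); first exact: h.
under eq_fun do rewrite -mulrBr.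
apply: le_lt_trans (norm2_bmul (M := `|M| + 1) mm _ (L2B fL (L2_tspan trigp))) _.
  by move=> x Ix; apply: (le_trans (mM x Ix)); apply: le_trans (ler_norm M) _; rewrite lerDl.
by rewrite mulrC -ltr_pdivlMr.
Qed.

Lemma tclosZ (c : R[i]) f : tclos f -> tclos (fun x => c * f x).
Proof.
apply: (tclos_bmul (M := cabs2 c)) => [|//|p trigp]; first exact: cmeas_cst.
apply: tclos_span; exact: tspanZ.
Qed.

Lemma tclos_cexpM k f : tclos f -> tclos (fun x => e k x * f x).
Proof.
apply: (tclos_bmul (M := 1)); first exact: cmeas_cexp.
  by move=> x _; rewrite cabs2_cexp.
by move=> p trigp; apply: tclos_span; exact: tspan_cexpM.
Qed.

Lemma tclos0 : tclos (fun=> 0). Proof. exact/tclos_span/tspan0. Qed.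

Lemma tclos1 : tclos (fun=> 1).
Proof.
have := tclos_span (tspan_cexp R 0); congr tclos.
by apply/funext => x; rewrite cexp0.
Qed.

Lemma tclos_sum I (r : seq I) (F : I -> R -> R[i]) :
  (forall i, tclos (F i)) -> tclos (fun x => \sum_(i <- r) F i x).
Proof.
move=> FL; elim: r => [|i r IH].
  by under eq_fun do rewrite big_nil; exact: tclos0.
by under eq_fun do rewrite big_cons; apply: tclosD.
Qed.

(** By commutativity, [m * e k] is a member of the closure times an exponential, so [tclos_cexpM]
    covers the trigonometric polynomials; boundedness of multiplication by [m] extends this to their
    closure. *)
Lemma tclosM (m : R -> R[i]) (M : R) f : tclos m ->
  (forall x, I0 x -> cabs2 (m x) <= M) -> tclos f -> tclos (fun x => m x * f x).
Proof.
move=> mc mM; apply: (tclos_bmul (M := M)) => //.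
  exact: L2_meas (tclos_L2 mc).
move=> p [s [a [_ ->]]]; rewrite /trigp.
under eq_fun do rewrite mulr_sumr; apply: tclos_sum => k.
under eq_fun do rewrite mulrCA [m _ * _]mulrC.
exact/tclosZ/tclos_cexpM.
Qed.

Definition rclos u := tclos (fun x => (u x)%:C%C).

Lemma RC_D (a b : R) : (a + b)%:C%C = a%:C%C + b%:C%C.
Proof. by apply: complexP; rewrite /= ?addr0. Qed.
Lemma RC_M (a b : R) : (a * b)%:C%C = a%:C%C * b%:C%C.
Proof. by apply: complexP; rewrite !ReImE/=; ring. Qed.

Lemma rclos_meas u : rclos u -> measurable_fun I0 u.
Proof. by move=> /tclos_L2/L2_meas[]. Qed.

Lemma rclosD u v : rclos u -> rclos v -> rclos (fun x => u x + v x).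
Proof. by move=> hu hv; rewrite /rclos; under eq_fun do rewrite RC_D; exact: tclosD. Qed.

Lemma rclosZ c u : rclos u -> rclos (fun x => c * u x).
Proof. by move=> hu; rewrite /rclos; under eq_fun do rewrite RC_M; exact: tclosZ. Qed.

Lemma rclos_cst c : rclos (fun=> c).
Proof.
have : rclos (fun=> c * 1) by apply: rclosZ; exact: tclos1.
by rewrite mulr1.
Qed.

Lemma rclosM u v : rclos u -> (forall x, I0 x -> -1 <= u x <= 1) -> rclos v ->
  rclos (fun x => u x * v x).
Proof.
move=> hu u1 hv; rewrite /rclos; under eq_fun do rewrite RC_M.
apply: (tclosM (M := 1)) hu _ hv => x Ix.
by rewrite /cabs2/= expr0n/= addr0; have := u1 _ Ix; nra.
Qed.

Lemma rclosX u n : rclos u -> (forall x, I0 x -> -1 <= u x <= 1) ->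
  rclos (fun x => u x ^+ n).
Proof.
move=> hu u1; elim: n => [|n IH].
  by under eq_fun do rewrite expr0; exact: rclos_cst.
by under eq_fun do rewrite exprS; exact: rclosM.
Qed.

Lemma rclos_step n u : rclos u -> (forall x, I0 x -> -1 <= u x <= 1) ->
  rclos (fun x => stepn n (u x)).
Proof.
move=> hu u1.
have h1 : rclos (fun x => (1 - u x) / 2).
  have : rclos (fun x => 2^-1 + (- 2^-1) * u x).
    by apply: rclosD; [exact: rclos_cst|exact: rclosZ].
  by congr rclos; apply/funext => x; lra.
have b1 x : I0 x -> -1 <= (1 - u x) / 2 <= 1.
  by move=> /u1 /andP[]; lra.
have h2 : rclos (fun x => 1 - ((1 - u x) / 2) ^+ n).
  have : rclos (fun x => 1 + (- 1) * ((1 - u x) / 2) ^+ n).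
    by apply: rclosD; [exact: rclos_cst|apply: rclosZ; exact: rclosX].
  by congr rclos; apply/funext => x; rewrite mulN1r.
apply: rclosX => // x /u1/andP[a b].
have s0 : 0 <= (1 - u x) / 2 by lra.
have s1 : (1 - u x) / 2 <= 1 by lra.
have y0 := exprn_ge0 n s0; have y1 := exprn_ile1 n s0 s1.
by apply/andP; split; lra.
Qed.

Lemma L2_real u : measurable_fun I0 u -> integrableI0 (fun x => u x ^+ 2) ->
  L2 (fun x => (u x)%:C%C).
Proof.
move=> mu_ iu; apply/L2P; split; first exact: cmeas_real.
by apply: integrableI0_ext iu => x _; rewrite /cabs2/= expr0n/= addr0.
Qed.

Lemma dominated_norm2 (u_ : nat -> R -> R) u h :
  (forall n, measurable_fun I0 (u_ n)) -> measurable_fun I0 u ->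
  (forall x, I0 x -> u_ n x @[n --> \oo] --> u x) ->
  (forall n x, I0 x -> (u x - u_ n x) ^+ 2 <= h x) -> integrableI0 h ->
  norm2 (fun x => (u x)%:C%C - (u_ n x)%:C%C) @[n --> \oo] --> (0 : R).
Proof.
move=> mu_n mu_ cu uh ih.
have mD n : measurable_fun I0 (fun x => (u x - u_ n x) ^+ 2).
  by apply: measurable_funX; exact: measurable_funB.
have := @dominated_convergence _ _ R mu I0 (@measurable_I0L R)
  (fun n x => ((u x - u_ n x) ^+ 2)%:E) (cst 0%E) (EFin \o h).
case.
- by move=> n; apply/measurable_EFinP; exact: mD.
- exact: measurable_cst.
- apply: aeW => x Ix; apply: cvg_EFin; first exact: nearW.
  rewrite /comp/= -[0 in X in _ --> X](expr0n R 2) -(subrr (u x)).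
  apply: (@cvg_comp _ _ _ (fun n => u x - u_ n x) (fun y => y ^+ 2) _ _ _ _).
    by apply: cvgB; [exact: cvg_cst|exact: cu].
  exact: exprn_continuous.
- exact: ih.
- by apply: aeW => x n Ix; rewrite /= lee_fin ger0_norm ?sqr_ge0// uh.
move=> _ _; rewrite integral0 => c.
have E n : norm2 (fun x => (u x)%:C%C - (u_ n x)%:C%C) =
    fine (\int[mu]_(x in I0) ((u x - u_ n x) ^+ 2)%:E)%E; last first.
  by under eq_fun do rewrite E; exact: fine_cvg c.
rewrite norm2E; apply: Rint_ext => x _.
by rewrite /cabs2 !ReImE/= oppr0 addr0 expr0n/= addr0.
Qed.

Lemma rclos_dominated (u_ : nat -> R -> R) u h :
  (forall n, rclos (u_ n)) -> L2 (fun x => (u x)%:C%C) ->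
  (forall x, I0 x -> u_ n x @[n --> \oo] --> u x) ->
  (forall n x, I0 x -> (u x - u_ n x) ^+ 2 <= h x) -> integrableI0 h -> rclos u.
Proof.
move=> ru uL cu uh ih; apply: tclos_closed => // eps e0.
have := dominated_norm2 (fun n => rclos_meas (ru n)) (proj1 (L2_meas uL)) cu uh ih.
move=> /cvgrPdist_lt /(_ _ e0)[N _ /(_ N (leqnn N))] /=.
rewrite sub0r normrN => lt; exists (fun x => (u_ N x)%:C%C); first exact: ru.
exact: le_lt_trans (ler_norm _) lt.
Qed.

(** The [stepn n (u x)] are polynomials in [u] with values in [0, 1], so they converge to the
    indicator of [u > 0] with a constant dominating function. *)
Lemma rclos_pos u : rclos u -> (forall x, I0 x -> -1 <= u x <= 1) ->
  rclos (fun x => (0 < u x)%R%:R).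
Proof.
move=> hu u1.
have b01 (b : bool) : 0 <= (b%:R : R) <= 1 by case: b => /=; lra.
apply: (rclos_dominated (u_ := fun n x => stepn n (u x)) (h := fun=> 1)).
- by move=> n; exact: rclos_step.
- apply: (L2_bound (M := 1)).
    apply: cmeas_real; apply: (measurableT_comp (f := fun b : bool => b%:R : R)) => //.
    by apply: measurable_fun_ltr => //; exact: rclos_meas.
  by move=> x _; rewrite /cabs2/= expr0n/= addr0; have := b01 (0 < u x)%R; nra.
- by move=> x /u1; exact: stepn_cvg.
- move=> n x /u1 /(stepn_bound n); have := b01 (0 < u x)%R.
  move: (_%:R) (stepn _ _) => a b; nra.
- exact: integrableI0_cst.
Qed.

Lemma norm2_oo f : L2 f -> (forall x : R, - (1/2) < x < 1/2 -> f x = 0) -> norm2 f = 0.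
Proof.
move=> fL f0.
have c := Rint_Kn_cvg (L2_int fL).
have z n : Rintegral mu (Kn n) (fun x => cabs2 (f x)) = 0.
  transitivity (Rintegral mu (Kn n) (fun=> 0)).
    by apply: eq_Rintegral => x /set_mem/KnP/f0 ->; rewrite cabs2_0.
  by rewrite Rintegral_cst ?mul0r//; exact: measurable_KnL.
have c' : Rintegral mu (Kn n) (fun x => cabs2 (f x)) @[n --> \oo] --> (0 : R).
  by under eq_fun do rewrite z; exact: cvg_cst.
by rewrite norm2E; apply: (cvg_unique _ c c').
Qed.

Definition iclos : set (set R) := [set A | measurable A /\ rclos \1_A].

(** The two endpoints are negligible in L2. They must be ignored: the function whose sign detects a
    ray has the factor [cos (pi x)], which vanishes there. *)
Lemma iclos_rclos (A : set R) u : measurable A -> rclos u ->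
  (forall x : R, - (1/2) < x < 1/2 -> \1_A x = u x) -> iclos A.
Proof.
move=> mA ru Au; split => //.
have AL : L2 (fun x => (\1_A x)%:C%C : R[i]).
  apply: (L2_bound (M := 1)); first by apply: cmeas_real; exact: measurable_indic.
  by move=> x _; rewrite /cabs2/= expr0n/= addr0 indicE; case: (_ \in _) => /=; lra.
apply: tclos_closed => // eps e0; exists (fun x => (u x)%:C%C); first exact: ru.
rewrite norm2_oo//; first exact: L2B (tclos_L2 ru).
by move=> x h; rewrite Au// subrr.
Qed.

Lemma iclos0 : iclos set0.
Proof. by split => //; rewrite indic0; exact: rclos_cst. Qed.

Lemma iclosC A : iclos A -> iclos (~` A).
Proof.
move=> [mA rA]; apply: (@iclos_rclos _ (fun x => 1 + (-1) * \1_A x)).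
- exact: measurableC.
- by apply: rclosD; [exact: rclos_cst|exact: rclosZ].
- by move=> x _; rewrite !indicE in_setC; case: (_ \in _) => /=; lra.
Qed.

Lemma iclosU A B : iclos A -> iclos B -> iclos (A `|` B).
Proof.
move=> [mA rA] [mB rB].
apply: (@iclos_rclos _ (fun x => \1_A x + \1_B x + (-1) * (\1_A x * \1_B x))).
- exact: measurableU.
- apply: rclosD; first exact: rclosD.
  apply: rclosZ; apply: rclosM => // x _.
  by rewrite indicE; case: (_ \in _) => /=; lra.
- by move=> x _; rewrite !indicE in_setU; do 2 case: (_ \in _) => /=; lra.
Qed.

Lemma iclos_bigcup (A : (set R)^nat) : (forall n, iclos (A n)) -> iclos (\bigcup_k A k).
Proof.
move=> hA; pose B n := \bigcup_(k in `I_n) A k.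
have hB n : iclos (B n).
  elim: n => [|n IH]; first by rewrite /B II0 bigcup_set0; exact: iclos0.
  by rewrite /B bigcup_mkord big_ord_recr/= -bigcup_mkord; exact: iclosU.
have mU : measurable (\bigcup_k A k) by apply: bigcup_measurable => k _; case: (hA k).
split => //; apply: (rclos_dominated (u_ := fun n => \1_(B n)) (h := fun=> 1)).
- by move=> n; case: (hB n).
- apply: (L2_bound (M := 1)); first by apply: cmeas_real; exact: measurable_indic.
  by move=> x _; rewrite /cabs2/= expr0n/= addr0 indicE; case: (_ \in _) => /=; lra.
- move=> x _; have [xU|xU] := pselect ((\bigcup_k A k) x).
    have [k _ Ak] := xU.
    apply: cvg_near_cst; exists k.+1 => // n /= kn.
    by rewrite !indicE !mem_set//; exists k.
  apply: cvg_near_cst; apply: nearW => n.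
  by rewrite !indicE !memNset// => -[k _ Ak]; apply: xU; exists k.
- by move=> n x _; rewrite !indicE; do 2 case: (_ \in _) => /=; lra.
- exact: integrableI0_cst.
Qed.

Lemma rclos_cos : rclos (fun x => cos (2 * pi * x)).
Proof.
have : tclos (fun x => Complex 2^-1 0 * e 1 x + Complex 2^-1 0 * e (-1) x).
  by apply: tclosD; apply: tclosZ; apply: tclos_span; exact: tspan_cexp.
congr tclos; apply/funext => x.
apply: complexP; rewrite !ReImE/= mulrN1z mulr1z !mulr1;
  by rewrite (mulrN1 (2 * pi)) (mulNr (2 * pi)) ?cosN ?sinN; field.
Qed.

Lemma rclos_sin : rclos (fun x => sin (2 * pi * x)).
Proof.
have : tclos (fun x => Complex 0 (- 2^-1) * e 1 x + Complex 0 2^-1 * e (-1) x).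
  by apply: tclosD; apply: tclosZ; apply: tclos_span; exact: tspan_cexp.
congr tclos; apply/funext => x.
apply: complexP; rewrite !ReImE/= mulrN1z mulr1z !mulr1;
  by rewrite (mulrN1 (2 * pi)) (mulNr (2 * pi)) ?cosN ?sinN; field.
Qed.

(* On the open interval, [cos (pi x)] is positive and [sin (pi (x - t))] has the
   sign of [x - t]; their product is a trigonometric polynomial of degree 1. *)
Lemma iclos_ray (t : R) : iclos `]t, +oo[%classic.
Proof.
have [t1|t1] := leP (1/2) t.
  apply: (@iclos_rclos _ (fun=> 0)) => //; first exact: rclos_cst.
  move=> x /andP[_ x1]; rewrite indicE memNset//= in_itv/= andbT; apply/negP.
  by rewrite -leNgt; lra.
have [t2|t2] := leP t (- (1/2)).
  apply: (@iclos_rclos _ (fun=> 1)) => //; first exact: rclos_cst.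
  by move=> x /andP[x1 _]; rewrite indicE mem_set//= in_itv/= andbT; lra.
pose u (x : R) := 2^-1 * cos (pi * t) * sin (2 * pi * x) +
   (- 2^-1 * sin (pi * t)) * (1 + cos (2 * pi * x)).
have uE x : u x = cos (pi * x) * sin (pi * (x - t)).
  rewrite /u (_ : 2 * pi * x = pi * x + pi * x); last by ring.
  rewrite (_ : pi * (x - t) = pi * x - pi * t); last by ring.
  rewrite sinB sinD cosD.
  have := cos2Dsin2 (pi * x); set c := cos (pi * x); set d := sin (pi * x) => cd.
  by rewrite (_ : d * d = 1 - c * c); [field|rewrite -cd; ring].
apply: (@iclos_rclos _ (fun x => (0 < u x)%R%:R)) => //.
  apply: rclos_pos.
    apply: rclosD; first exact/rclosZ/rclos_sin.
    by apply: rclosZ; apply: rclosD; [exact: rclos_cst|exact: rclos_cos].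
  move=> x _; rewrite uE -ler_norml normrM mulr_ile1// ler_norml.
    by rewrite cos_le1 cos_geN1.
  by rewrite sin_le1 sin_geN1.
move=> x h; rewrite uE pmulr_rgt0 ?cos_pix_gt0//.
have p0 := pi_gt0 R; have /andP[x1 x2] := h.
rewrite indicE; case: (ltP t x) => tx.
  rewrite mem_set/= ?in_itv/= ?tx//; apply/esym; rewrite (_ : 0 < _)//.
  by apply: sin_gt0_pi; apply/andP; split; nra.
rewrite memNset/= ?in_itv/= ?andbT; last by apply/negP; rewrite -leNgt.
rewrite ltNge (_ : pi * (x - t) = - (pi * (t - x))); last by ring.
rewrite sinN oppr_le0 sin_ge0_pi//.
by apply/andP; split; nra.
Qed.

Lemma iclosP (A : set R) : measurable A -> iclos A.
Proof.
move=> mA; have : @measurable _ (g_sigma_algebraType (@RGenOInfty.G R)) A.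
  by rewrite -RGenOInfty.measurableE.
apply: smallest_sub => [|_ [t ->]]; last exact: iclos_ray.
split; first exact: iclos0.
- by move=> B /iclosC; rewrite setTD.
- exact: iclos_bigcup.
Qed.

Lemma rclos_nnsfun (g : {nnsfun R >-> R}) : rclos g.
Proof.
rewrite /rclos; under eq_fun do rewrite fimfunE fsbig_finite//=.
have -> : (fun x => (\sum_(y <- enum_fset (fset_set (range g))) y * \1_(g @^-1` [set y]) x)%:C%C)
   = fun x => \sum_(y <- enum_fset (fset_set (range g))) (y * \1_(g @^-1` [set y]) x)%:C%C.
  apply/funext => x; elim: (enum_fset _) => [|y r IH]; first by rewrite !big_nil.
  by rewrite !big_cons RC_D IH.
apply: tclos_sum => y; apply: rclosZ.
by have [] := @iclosP (g @^-1` [set y]) (measurable_sfunP g (measurable_set1 y)).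
Qed.

(** The approximating simple functions lie between 0 and [u], so the squared errors are dominated by
    [u^2]. *)
Lemma rclos_ge0 u : measurable_fun I0 u -> (forall x, I0 x -> 0 <= u x) ->
  integrableI0 (fun x => u x ^+ 2) -> rclos u.
Proof.
move=> mu_ u0 iu.
have mE : measurable_fun I0 (EFin \o u) by exact/measurable_EFinP.
have u0E x : I0 x -> (0 <= (EFin \o u) x)%E by move=> /u0; rewrite lee_fin.
apply: (rclos_dominated (u_ := fun n => nnsfun_approx (@measurable_I0 R) mE n)
  (h := fun x => u x ^+ 2)) => //.
- by move=> n; exact: rclos_nnsfun.
- exact: L2_real.
- move=> x Ix; under eq_fun do rewrite nnsfun_approxE.
  have := @cvg_approx _ _ R I0 (EFin \o u) x u0E Ix; apply.
  exact: ltry.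
- move=> n x Ix; rewrite nnsfun_approxE.
  have := @le_approx _ _ R I0 (EFin \o u) n x u0E Ix; rewrite lee_fin.
  have : 0 <= approx I0 (EFin \o u) n x.
    by rewrite -(nnsfun_approxE (@measurable_I0 R) mE).
  by have := u0 _ Ix; move: (u x) (approx _ _ _ _) => a b; nra.
Qed.

Lemma rclos_L2 u : measurable_fun I0 u -> integrableI0 (fun x => u x ^+ 2) -> rclos u.
Proof.
move=> mu_ iu.
have h v : measurable_fun I0 v -> (forall x, I0 x -> v x ^+ 2 <= u x ^+ 2) ->
    (forall x, I0 x -> 0 <= v x) -> rclos v.
  move=> mv vu v0; apply: rclos_ge0 => //; apply: integrableI0_le iu.
    exact: measurable_funX.
  by move=> x Ix; rewrite ger0_norm ?sqr_ge0// vu.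
have : rclos (fun x => Num.max (u x) 0 + (-1) * Num.max (- u x) 0).
  apply: rclosD; last apply: rclosZ; apply: h.
  - by apply: measurable_maxr.
  - by move=> x _; case: (leP (u x) 0) => _ //; rewrite expr0n/= sqr_ge0.
  - by move=> x _; rewrite le_max lexx orbT.
  - by apply: measurable_maxr => //; exact: measurableT_comp.
  - by move=> x _; case: (leP (- u x) 0) => _; rewrite ?sqrrN// expr0n/= sqr_ge0.
  - by move=> x _; rewrite le_max lexx orbT.
congr rclos; apply/funext => x; rewrite /Num.max; case: ifP; case: ifP; lra.
Qed.

Lemma tclos_all f : L2 f -> tclos f.
Proof.
move=> fL; have [mr mi] := L2_meas fL; have ii := L2_int fL.
have : tclos (fun x => (complex.Re (f x))%:C%C + (Complex 0 1) * (complex.Im (f x))%:C%C).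
  apply: tclosD; last apply: tclosZ; apply: rclos_L2 => //; apply: integrableI0_le ii;
    try exact: measurable_funX; move=> x _; rewrite ger0_norm ?sqr_ge0// /cabs2.
  - by rewrite lerDl sqr_ge0.
  - by rewrite lerDr sqr_ge0.
by congr tclos; apply/funext => x; apply: complexP; rewrite !ReImE/=; ring.
Qed.

(** Together with [bessel] this is Parseval's identity; the finite form is what lower bounds on
    [\esum] consume. *)
Lemma parseval f (eps : R) : L2 f -> 0 < eps ->
  exists2 s : seq int, uniq s & norm2 f - eps < \sum_(k <- s) cabs2 (inner f (e k)).
Proof.
move=> fL e0; have [_ /(_ _ e0)[_ [s [a [us ->]]] lt]] := tclos_all fL.
exists s => //; have := norm2_sub_trigp_ge a us fL; lra.
Qed.

End Density.

(** * Frame bounds *)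

Section FramesOfExponentials.
Variable R : realType.
Notation mu := (@lebesgue_measure R).
Notation I0 := (@I0 R).
Notation "'\I' u" := (Rintegral mu I0 u) (at level 10, u at level 9).
Notation E := (@cexp2pi R).
Notation e := (fun k : int => @cexp2pi R k%:~R).
Implicit Types (f g : R -> R[i]) (u v w h : R -> R) (xi : R) (s : seq int).

Lemma esum_ge_seq (a : int -> R) (x : R) :
  (forall d : R, 0 < d -> exists2 s, uniq s & x - d < \sum_(k <- s) a k) ->
  (x%:E <= \esum_(k in [set: int]) (a k)%:E)%E.
Proof.
move=> H; apply/lee_addgt0Pr => d /H[s us lt].
apply: (@le_trans _ _ ((\sum_(k <- s) a k)%:E + d%:E)%E).
  by rewrite -EFinD lee_fin; lra.
by apply: leeD => //; exact: seq_le_esum.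
Qed.

Lemma FgE0 xi (k : int) : 0 <= k -> Fg xi k = e k.
Proof. by rewrite /Fg => ->. Qed.

Lemma FgEN xi (k : int) : k < 0 -> Fg xi k = E (xi + k%:~R).
Proof. by rewrite /Fg leNgt => ->. Qed.

Lemma L2_Fg xi k : L2 (Fg xi k).
Proof. by rewrite /Fg; case: ifP => _; exact: L2_cexp. Qed.
Hint Resolve L2_Fg : core.

Lemma inner_cexp_shift xi (k : int) f :
  inner f (E (xi + k%:~R)) = inner (fun x => E (- xi) x * f x) (e k).
Proof. by rewrite inner_cexpM opprK addrC. Qed.

(** The constant 2 arises because the family is drawn from two orthonormal systems, the [e k] and
    their translates by [xi] in frequency, each with Bessel bound 1. *)
Lemma Fg_bessel xi s f : uniq s -> L2 f ->
  \sum_(k <- s) cabs2 (inner f (Fg xi k)) <= 2 * norm2 f.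
Proof.
move=> us fL; have gL := L2_cexpM (- xi) fL.
apply: (@le_trans _ _ (\sum_(k <- s) (cabs2 (inner f (e k)) +
    cabs2 (inner (fun x => E (- xi) x * f x) (e k))))).
  apply: ler_sum => k _; case: (leP 0 k) => k0.
    by rewrite FgE0// lerDl cabs2_ge0.
  by rewrite FgEN// inner_cexp_shift lerDr cabs2_ge0.
rewrite big_split/= mulr2n mulrDl !mul1r; apply: lerD; first exact: bessel.
by rewrite -(norm2_cexpM (- xi) f); exact: bessel.
Qed.

Definition cpart xi f : R -> R[i] := fun x => (cos (pi * xi * x))%:C%C * (E (- (xi / 2)) x * f x).
Definition spart xi f : R -> R[i] :=
  fun x => Complex 0 (sin (pi * xi * x)) * (E (- (xi / 2)) x * f x).

Lemma cabs2_real (a : R) : cabs2 a%:C%C = a ^+ 2.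
Proof. by rewrite /cabs2/= expr0n addr0. Qed.
Lemma cabs2_imag (a : R) : cabs2 (Complex 0 a) = a ^+ 2.
Proof. by rewrite /cabs2/= expr0n add0r. Qed.

Lemma cos2_le1 (y : R) : cos y ^+ 2 <= 1.
Proof. by have := cos2Dsin2 y; have := sqr_ge0 (sin y); lra. Qed.
Lemma sin2_le1 (y : R) : sin y ^+ 2 <= 1.
Proof. by have := cos2Dsin2 y; have := sqr_ge0 (cos y); lra. Qed.

Lemma cmeas_imag u : measurable_fun I0 u -> cmeas (fun x => Complex 0 (u x)).
Proof. by move=> mu_; split => //; exact: measurable_cst. Qed.

Lemma L2_cpart xi f : L2 f -> L2 (cpart xi f).
Proof.
move=> fL; apply: (L2_bmul (M := 1) _ _ (L2_cexpM _ fL)).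
  by apply: cmeas_real; exact: measurable_cosM.
by move=> x _; rewrite cabs2_real cos2_le1.
Qed.

Lemma L2_spart xi f : L2 f -> L2 (spart xi f).
Proof.
move=> fL; apply: (L2_bmul (M := 1) _ _ (L2_cexpM _ fL)).
  by apply: cmeas_imag; exact: measurable_sinM.
by move=> x _; rewrite cabs2_imag sin2_le1.
Qed.
Hint Resolve L2_cpart L2_spart : core.

Lemma cexp_half xi x : E (xi / 2) x = Complex (cos (pi * xi * x)) (sin (pi * xi * x)).
Proof. by rewrite /cexp2pi (_ : 2 * pi * (xi / 2) * x = pi * xi * x)//; field. Qed.

Lemma cexp_Nhalf xi x : E (- (xi / 2)) x = Complex (cos (pi * xi * x)) (- sin (pi * xi * x)).
Proof. by rewrite -cexp_conj cexp_half. Qed.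

Lemma cpartDspart xi f : (fun x => cpart xi f x + spart xi f x) = f.
Proof.
apply/funext => x; rewrite /cpart /spart -mulrDl.
rewrite (_ : _ + _ = E (xi / 2) x); last first.
  by rewrite cexp_half; apply: complexP; rewrite !ReImE/= ?addr0 ?add0r.
by rewrite mulrA -cexpD subrr cexp0 mul1r.
Qed.

Lemma cpartBspart xi f :
  (fun x => cpart xi f x - spart xi f x) = fun x => E (- xi) x * f x.
Proof.
apply/funext => x; rewrite /cpart /spart -mulrBl.
rewrite (_ : _ - _ = E (- (xi / 2)) x); last first.
  by rewrite cexp_Nhalf; apply: complexP; rewrite !ReImE/= ?subr0 ?sub0r ?oppr0 ?addr0.
by rewrite mulrA -cexpD (_ : - (xi / 2) - xi / 2 = - xi)//; field.
Qed.

(* Up to the unimodular factor [e^(i pi xi x)], the family is the image of the Fourier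
   basis under [cos (pi xi x) -+ i sin (pi xi x)], the sign being that of the frequency;
   the cosine part dominates the sine part as long as [|xi| < 1/2]. *)
Lemma inner_Fg xi k f : L2 f -> inner f (Fg xi k) =
  if 0 <= k then inner (cpart xi f) (e k) + inner (spart xi f) (e k)
  else inner (cpart xi f) (e k) - inner (spart xi f) (e k).
Proof.
move=> fL; have eL := @L2_cexp R k%:~R; case: (leP 0 k) => k0.
  by rewrite FgE0// -innerDl ?cpartDspart//; auto.
by rewrite FgEN// inner_cexp_shift -innerBl ?cpartBspart//; auto.
Qed.

(** Whatever the sign in [inner_Fg], the cosine coefficient is a coefficient in the family plus or
    minus the sine coefficient. *)
Lemma cpart_le t xi k f : 0 < t -> L2 f -> cabs2 (inner (cpart xi f) (e k)) <=
  (1 + t) * cabs2 (inner f (Fg xi k)) + (1 + t^-1) * cabs2 (inner (spart xi f) (e k)).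
Proof.
move=> t0 fL; rewrite inner_Fg//; set x := inner (cpart xi f) _; set y := inner _ _.
case: ifP => _.
  by have := cabs2D_le (x + y) (- y) t0; rewrite addrK cabs2N.
by have := cabs2D_le (x - y) y t0; rewrite subrK.
Qed.

(** On the interval [|2 pi xi x| <= pi |xi| <= pi], and the cosine decreases on [[0, pi]]. By the
    half-angle formulas this compares the weights [cos^2] and [sin^2] with constants. *)
Lemma cos_two_pi_ge xi x : - (1/2) <= xi <= 1/2 -> I0 x ->
  cos (pi * xi) <= cos (2 * (pi * xi * x)).
Proof.
move=> h; rewrite /I0/= in_itv/= => hx; have p0 := pi_gt0 R.
have h' : `|xi| <= 1/2 by rewrite ler_norml.
have hx' : `|x| <= 1/2 by rewrite ler_norml.
rewrite -(cos_norm (pi * xi)) -(cos_norm (2 * _)) !normrM.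
rewrite (ger0_norm (ltW p0)) (ger0_norm (_ : 0 <= 2))//.
have n1 := normr_ge0 xi; have n2 := normr_ge0 x.
set a := `|xi| in h' n1 *; set b := `|x| in hx' n2 *.
have pa : 0 <= pi * a by rewrite mulr_ge0// ltW.
have le : 2 * (pi * a * b) <= pi * a by nra.
have le2 : pi * a <= pi by nra.
rewrite leNgt; apply/negP; rewrite ltr_cos ?in_itv/=.
- by rewrite ltNge le.
- by have := mulr_ge0 pa n2; lra.
- by have := mulr_ge0 pa n2; lra.
Qed.

Lemma cos2_half (y : R) : cos y ^+ 2 = (1 + cos (2 * y)) / 2.
Proof. by rewrite mulr_natl cos_mulr2n mulr2n; field. Qed.
Lemma sin2_half (y : R) : sin y ^+ 2 = (1 - cos (2 * y)) / 2.
Proof. by rewrite sin2cos2 cos2_half; field. Qed.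

Lemma norm2_cpart_ge xi f : - (1/2) <= xi <= 1/2 -> L2 f ->
  (1 + cos (pi * xi)) / 2 * norm2 f <= norm2 (cpart xi f).
Proof.
move=> h fL; rewrite !norm2E -RintZ; last exact: L2_int.
apply: Rint_le; [exact: integrableI0Z (L2_int fL)|exact: L2_int (L2_cpart xi fL)|].
move=> x Ix; rewrite !cabs2M cabs2_cexp mul1r cabs2_real cos2_half.
apply: ler_wpM2r; first exact: cabs2_ge0.
by have := cos_two_pi_ge h Ix; lra.
Qed.

Lemma norm2_spart_le xi f : - (1/2) <= xi <= 1/2 -> L2 f ->
  norm2 (spart xi f) <= (1 - cos (pi * xi)) / 2 * norm2 f.
Proof.
move=> h fL; rewrite !norm2E -RintZ; last exact: L2_int.
apply: Rint_le; [exact: L2_int (L2_spart xi fL)|exact: integrableI0Z (L2_int fL)|].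
move=> x Ix; rewrite !cabs2M cabs2_cexp mul1r cabs2_imag sin2_half.
apply: ler_wpM2r; first exact: cabs2_ge0.
by have := cos_two_pi_ge h Ix; lra.
Qed.

Definition lower_bound xi : R := cos (pi * xi) / 2 / (1 + 2 / cos (pi * xi)).

Lemma lower_bound_gt0 xi : - (1/2) < xi < 1/2 -> 0 < lower_bound xi.
Proof.
move=> /cos_pix_gt0 b0; rewrite /lower_bound divr_gt0 ?divr_gt0//.
by rewrite addr_gt0// divr_gt0.
Qed.

Lemma lower_bound_le2 xi : - (1/2) < xi < 1/2 -> lower_bound xi <= 2.
Proof.
move=> /cos_pix_gt0 b0; rewrite /lower_bound ler_pdivrMr; last by rewrite addr_gt0// divr_gt0.
have : 0 < 2 / cos (pi * xi) by rewrite divr_gt0.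
by have := cos_le1 (pi * xi); lra.
Qed.

(* With [c = cos (pi xi)], the weight [t = 2 / c] makes [(1 + 1/t) (1 - c) / 2 <= 1/2]: of
   the coefficient [(1 + c) / 2] of the cosine part at least [c / 2] is left. *)
Lemma lower_bound_arith xi (X Y N S : R) : - (1/2) < xi < 1/2 -> 0 <= N ->
  (1 + cos (pi * xi)) / 2 * N <= X -> Y <= (1 - cos (pi * xi)) / 2 * N ->
  X <= (1 + 2 / cos (pi * xi)) * S + (1 + (2 / cos (pi * xi))^-1) * Y ->
  lower_bound xi * N <= S.
Proof.
move=> h N0 hX hY hS; have b0 := cos_pix_gt0 h; have b1 := cos_le1 (pi * xi).
rewrite /lower_bound; set b := cos _ in hX hY hS b0 b1 *.
have t0 : 0 < 1 + 2 / b by rewrite addr_gt0// divr_gt0.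
rewrite mulrAC ler_pdivrMr// [S * _]mulrC.
have : (1 + (2 / b)^-1) * Y <= (1 + b / 2) * ((1 - b) / 2 * N).
  by rewrite invf_div ler_wpM2l//; lra.
have : 0 <= b ^+ 2 * N by rewrite mulr_ge0// sqr_ge0.
have : 0 <= b * N by rewrite mulr_ge0// ltW.
lra.
Qed.

Lemma Fg_lower xi f (d : R) : - (1/2) < xi < 1/2 -> L2 f -> 0 < d ->
  exists2 s, uniq s & lower_bound xi * norm2 f - d < \sum_(k <- s) cabs2 (inner f (Fg xi k)).
Proof.
move=> h fL d0; have b0 := cos_pix_gt0 h.
have h' : - (1/2) <= xi <= 1/2 by lra.
set t := 2 / cos (pi * xi); have t0 : 0 < t by rewrite divr_gt0.
have t1 : 0 < 1 + t by lra.
(* The sum over the family enters below with the factor [1 + t], so the tolerance in Parseval's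
   identity is scaled by it. *)
have d'0 : 0 < d * (1 + t) by rewrite mulr_gt0.
have [s us lt] := parseval (L2_cpart xi fL) d'0.
exists s => //; set S := \sum_(k <- s) _.
suff : lower_bound xi * norm2 f < S + d by lra.
have ltS : norm2 (cpart xi f) < (1 + t) * (S + d) + (1 + t^-1) * norm2 (spart xi f).
  have le1 : \sum_(k <- s) cabs2 (inner (cpart xi f) (e k)) <=
      (1 + t) * S + (1 + t^-1) * \sum_(k <- s) cabs2 (inner (spart xi f) (e k)).
    by rewrite !mulr_sumr -big_split/=; apply: ler_sum => k _; exact: cpart_le.
  have := bessel us (L2_spart xi fL).
  move=> /(ler_wpM2l (_ : 0 <= 1 + t^-1)) H.
  have {}H := H ltac:(rewrite addr_ge0// invr_ge0 ltW//).
  lra.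
(* [lower_bound_arith] is an inequality between weak bounds; the strictness of [ltS] is stored in
   [d2] and recovered at the end. *)
have [d2 d20 ltS2] : exists2 d2, 0 < d2 &
   norm2 (cpart xi f) <= (1 + t) * (S + d - d2) + (1 + t^-1) * norm2 (spart xi f).
  exists (((1 + t) * (S + d) + (1 + t^-1) * norm2 (spart xi f) - norm2 (cpart xi f)) / (1 + t)).
    by rewrite divr_gt0// subr_gt0.
  rewrite mulrBr [(1 + t) * (_ / _)]mulrC divfK ?gt_eqF//; lra.
have := lower_bound_arith h (norm2_ge0 f) (norm2_cpart_ge h' fL) (norm2_spart_le h' fL) ltS2.
lra.
Qed.

(** It embeds the family of [xi] in that of [xi + n], a frequency [xi + k] with [k < 0] being
    [(xi + n) + (k - n)]. The indices from [-n] to [-1] are missed: they are the redundant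
    vectors. *)
Definition shift_index (n : nat) (k : int) : int := if 0 <= k then k else k - n%:Z.

Lemma shift_index_inj n : injective (shift_index n).
Proof. by move=> j k; rewrite /shift_index; case: (leP 0 j); case: (leP 0 k); lia. Qed.

Lemma Fg_shift_index xi n k : Fg (xi + n%:R) (shift_index n k) = Fg xi k.
Proof.
rewrite /shift_index; case: (leP 0 k) => k0; first by rewrite !FgE0.
rewrite !FgEN//; last by lia.
by rewrite rmorphB/= addrACA addrC (_ : n%:R + - _ = 0) ?add0r//; exact: subrr.
Qed.

Lemma frame_of_lower xi (A : R) : 0 < A -> A <= 2 ->
  (forall f, L2 f -> ((A * norm2 f)%:E <=
     \esum_(k in [set: int]) (cabs2 (inner f (Fg xi k)))%:E)%E) -> frame (Fg xi).
Proof.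
move=> A0 A2 h; exists A, 2; do 2 split => //; move=> f fL; split; first exact: h.
by apply: esum_le_seq => s us; exact: Fg_bessel.
Qed.

Lemma Fg_esum_lower xi n f : - (1/2) < xi < 1/2 -> L2 f ->
  ((lower_bound xi * norm2 f)%:E <=
    \esum_(k in [set: int]) (cabs2 (inner f (Fg (xi + n%:R) k)))%:E)%E.
Proof.
move=> h fL; apply: esum_ge_seq => d d0; have [s us lt] := Fg_lower h fL d0.
exists [seq shift_index n k | k <- s]; first by rewrite map_inj_uniq//; exact: shift_index_inj.
by rewrite big_map; under eq_bigr do rewrite Fg_shift_index.
Qed.

Lemma Fg_frame xi n : - (1/2) < xi < 1/2 -> frame (Fg (xi + n%:R)).
Proof.
move=> h; apply: (frame_of_lower (lower_bound_gt0 h) (lower_bound_le2 h)) => f fL.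
exact: Fg_esum_lower.
Qed.

(** Multiplied by [E (- (xi / 2))], the combination becomes [cos p - i sin p'], where [p'] is the
    trigonometric polynomial [p] with the coefficients of negative index negated. Orthonormality
    gives [p] and [p'] the same norm, so the cosine term still dominates. *)
Lemma Fg_sum_lower xi s (a : int -> R[i]) : - (1/2) < xi < 1/2 -> uniq s ->
  lower_bound xi * \sum_(k <- s) cabs2 (a k) <=
  norm2 (fun x => \sum_(k <- s) a k * Fg xi k x).
Proof.
move=> h us; have h' : - (1/2) <= xi <= 1/2 by lra.
have b0 := cos_pix_gt0 h; set t := 2 / cos (pi * xi); have t0 : 0 < t by rewrite divr_gt0.
pose sg (k : int) : R[i] := if 0 <= k then 1 else -1.
pose a' k := sg k * a k.
have N' : norm2 (trigp s a') = norm2 (trigp s a).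
  rewrite !norm2_trigp//; apply: eq_bigr => k _; rewrite cabs2M /sg.
  by case: ifP; rewrite ?cabs2N /cabs2/= expr1n expr0n/= addr0 mul1r.
(* The factor [E (xi / 2)] cancels the one built into [cpart] and [spart]. *)
pose P := cpart xi (fun x => E (xi / 2) x * trigp s a x).
pose Q := spart xi (fun x => E (xi / 2) x * trigp s a' x).
have PL : L2 P by apply: L2_cpart; apply: L2_cexpM; exact: L2_trigp.
have QL : L2 Q by apply: L2_spart; apply: L2_cexpM; exact: L2_trigp.
set S := norm2 (fun x => _).
have SE : S = norm2 (fun x => P x - Q x).
  rewrite /S -(norm2_cexpM (- (xi / 2))); congr norm2; apply/funext => x.
  rewrite /P /Q /cpart /spart !mulrA -(mulrA _%:C%C) -(mulrA (Complex 0 _)) -!cexpD.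
  rewrite addNr cexp0 !mulr1 /trigp !mulr_sumr -sumrB; apply: eq_bigr => k _.
  rewrite /a' /sg /Fg mulrCA; case: ifP => k0.
    rewrite mul1r [in RHS]mulrCA [X in _ - X]mulrCA -mulrBr -mulrBl; congr (_ * (_ * _)).
    by rewrite cexp_Nhalf; apply: complexP; rewrite !ReImE/= ?subr0 ?sub0r ?oppr0 ?addr0.
  rewrite cexpD [E (- _) x * _]mulrA -cexpD (_ : - (xi / 2) + xi = xi / 2); last by field.
  rewrite (_ : E (xi / 2) x = (cos (pi * xi * x))%:C%C + Complex 0 (sin (pi * xi * x))).
    by ring.
  by rewrite cexp_half; apply: complexP; rewrite !ReImE/= ?addr0 ?add0r.
have hS : norm2 P <= (1 + t) * S + (1 + t^-1) * norm2 Q.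
  rewrite SE; have := norm2D_le t0 (L2B PL QL) QL.
  by under eq_fun do rewrite subrK.
have := lower_bound_arith (N := norm2 (trigp s a)) (X := norm2 P) (Y := norm2 Q) (S := S) h
   (norm2_ge0 _).
rewrite norm2_trigp//; apply => //.
  rewrite -norm2_trigp// -(norm2_cexpM (xi / 2) (trigp s a)); apply: norm2_cpart_ge => //.
  by apply: L2_cexpM; exact: L2_trigp.
rewrite -norm2_trigp// -N' -(norm2_cexpM (xi / 2) (trigp s a')); apply: norm2_spart_le => //.
by apply: L2_cexpM; exact: L2_trigp.
Qed.

(** On the compact [Kn n] the weight has a positive minimum, so the vanishing of the weighted
    integral forces that of [u] over [Kn n]; then let [n] grow. The weight may vanish at the
    endpoints. *)
Lemma positive_weight w u : (forall x : R, - (1/2) < x < 1/2 ->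
    {for x, continuous w} /\ 0 < w x) ->
  (forall x, I0 x -> 0 <= u x) -> integrableI0 u -> integrableI0 (fun x => w x * u x) ->
  (forall x, I0 x -> 0 <= w x) ->
  \I (fun x => w x * u x) = 0 -> \I u = 0.
Proof.
move=> wc u0 iu iwu w0 z.
have c := Rint_Kn_cvg iu.
have iK v n : integrableI0 v -> mu.-integrable (Kn n) (EFin \o v).
  exact: (integrableS (@measurable_I0L R) (measurable_KnL n) (@Kn_sub R n)).
have zK n : Rintegral mu (Kn n) u = 0.
  have [] := @EVT_min R w (- rn R n) (rn R n).
  - by have := rn_gt0 R n; lra.
  - by apply: continuous_in_subspaceT => x /set_mem/KnP /wc[].
  move=> m hm mmin.
  have km : 0 < w m by have [] := wc m (@KnP R n m hm).
  apply/eqP; rewrite eq_le; apply/andP; split; last first.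
    by apply: Rintegral_ge0 => x /(@Kn_sub R n); exact: u0.
  rewrite -(pmulr_rle0 _ km) -RintegralZl ?iK//; last exact: measurable_KnL.
  apply: (@le_trans _ _ (Rintegral mu (Kn n) (fun x => w x * u x))).
    apply: le_Rintegral => [|||x Kx].
    - exact: measurable_KnL.
    - by apply: iK; exact: integrableI0Z.
    - exact: iK.
    - by rewrite ler_wpM2r ?mmin//; apply: u0; exact: (@Kn_sub R n).
  have zE : (\int[mu]_(x in I0) (w x * u x)%:E = 0)%E.
    rewrite -[LHS]fineK; first by congr EFin; exact: z.
    exact: (integrable_fin_num (@measurable_I0L R) iwu).
  rewrite /Rintegral (_ : (\int[mu]_(x in Kn n) _)%E = 0%E)//.
  apply/eqP; rewrite eq_le; apply/andP; split; last first.
    by apply: integral_ge0 => x /(@Kn_sub R n) Ix; rewrite lee_fin mulr_ge0 ?w0 ?u0.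
  rewrite -zE; apply: ge0_subset_integral.
  - exact: measurable_KnL.
  - exact: measurable_I0L.
  - by apply/measurable_EFinP; exact: (integrableI0_meas iwu).
  - by move=> x Ix; rewrite lee_fin mulr_ge0 ?w0 ?u0.
  - exact: (@Kn_sub R n).
have c' : Rintegral mu (Kn n) u @[n --> \oo] --> (0 : R).
  by under eq_fun do rewrite zK; exact: cvg_cst.
by apply: (cvg_unique _ c c').
Qed.

(** If all coefficients vanish, the cosine and sine parts have Fourier coefficients of equal
    modulus, hence equal norms. The difference of these norms is the integral of
    [(cos^2 - sin^2) |f|^2], and at [xi = -1/2] that weight is [cos (pi x)]. *)
Lemma Fg_complete_Nhalf : complete (Fg (- (1/2) : R)).
Proof.
move=> f fL; pose xi : R := - (1/2); rewrite -/xi => f0.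
have xy k : cabs2 (inner (cpart xi f) (e k)) = cabs2 (inner (spart xi f) (e k)).
  have := f0 k; rewrite inner_Fg//; case: ifP => _ /eqP.
    by rewrite addr_eq0 => /eqP ->; rewrite cabs2N.
  by rewrite subr_eq0 => /eqP ->.
have cL := L2_cpart xi fL; have sL := L2_spart xi fL.
have eqn : norm2 (cpart xi f) = norm2 (spart xi f).
  apply/eqP; rewrite eq_le; apply/andP; split; apply/ler_addgt0Pr => d d0.
    have [s us lt] := parseval cL d0; have := bessel us sL.
    by under eq_bigr do rewrite -xy; lra.
  have [s us lt] := parseval sL d0; have := bessel us cL.
  by under eq_bigr do rewrite xy; lra.
rewrite norm2E; apply: (@positive_weight (fun x => cos (pi * x))).
- by move=> x h; split; [exact: cosM_continuous|exact: cos_pix_gt0].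
- by move=> x _; exact: cabs2_ge0.
- exact: L2_int.
- apply: (integrableI0_le _ _ (L2_int fL)).
    by apply: measurable_funM; [exact: measurable_cosM|exact: cmeas_cabs2 (L2_meas fL)].
  move=> x _; rewrite normrM [X in _ * X]ger0_norm ?cabs2_ge0//.
  by rewrite ler_piMl ?cabs2_ge0// cos_max.
- exact: cos_pix_ge0.
have := eqn; move/eqP; rewrite -subr_eq0 !norm2E -RintN; last exact: L2_int.
rewrite -RintD; [|exact: L2_int|exact/integrableI0N/L2_int].
move=> /eqP H; rewrite -[RHS]H; apply: Rint_ext => x _.
rewrite !cabs2M cabs2_cexp !mul1r cabs2_real cabs2_imag cos2_half sin2_half.
rewrite (_ : 2 * (pi * xi * x) = - (pi * x)); last by rewrite /xi; field.
by rewrite cosN; field.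
Qed.

Lemma complete_shift_index xi n : complete (Fg xi) -> complete (Fg (xi + n%:R)).
Proof. by move=> c f fL f0; apply: c => // k; rewrite -(Fg_shift_index xi n). Qed.

(* With [z = e^(2 i pi x)] one has [e^(2 i pi xi x) = ((1 + z) / (1 + z^-1))^xi], and [annih a]
   is [z^-1 (1 + z^-1)^a] up to a constant: it is antianalytic, and dividing it by
   [e^(2 i pi xi x)] with [xi = - (a + 1)] gives the analytic [(1 + z)^a]. *)
Definition annih (a : R) : R -> R[i] := fun x => (cospow a x)%:C%C * E (- ((a + 2) / 2)) x.

Lemma cospow_sqr a x : I0 x -> cospow a x ^+ 2 = cospow (2 * a) x.
Proof.
by move=> Ix; rewrite /cospow (mulrC 2) powRrM powR_mulrn ?powR_ge0.
Qed.

Lemma cabs2_annih a x : I0 x -> cabs2 (annih a x) = cospow (2 * a) x.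
Proof. by move=> Ix; rewrite cabs2M cabs2_cexp mulr1 cabs2_real cospow_sqr. Qed.

Lemma L2_annih a : - (1/2) < a -> L2 (annih a).
Proof.
move=> ha; apply/L2P; split.
  by apply: cmeasM; [apply: cmeas_real; exact: measurable_cospow|exact: cmeas_cexp].
have : integrableI0 (cospow (2 * a)) by apply: integrableI0_cospow; lra.
by apply: integrableI0_ext => x Ix; rewrite cabs2_annih.
Qed.

Lemma norm2_annih a : norm2 (annih a) = \I (cospow (2 * a)).
Proof. by rewrite norm2E; apply: Rint_ext => x; exact: cabs2_annih. Qed.

Lemma inner_annih a (q : R) : -1 < a -> inner (annih a) (E q) =
  Complex (\I (fun x => cospow a x * cos (pi * (a + 2 + 2 * q) * x)))
          (- \I (fun x => cospow a x * sin (pi * (a + 2 + 2 * q) * x))).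
Proof.
move=> ha.
have h x : annih a x * conjc (E q x) = (cospow a x)%:C%C * E (- ((a + 2) / 2) - q) x.
  by rewrite /annih cexp_conj -mulrA -cexpD.
have hq x : 2 * pi * (- ((a + 2) / 2) - q) * x = - (pi * (a + 2 + 2 * q) * x) by field.
apply: complexP.
  rewrite Re_inner [RHS]/=; apply: Rint_ext => x _.
  by rewrite h Re_mul/= mul0r subr0 hq cosN.
rewrite Im_inner [RHS]/=.
have -> : \I (fun x => complex.Im (annih a x * conjc (E q x))) =
    \I (fun x => (-1) * (cospow a x * sin (pi * (a + 2 + 2 * q) * x))).
  by apply: Rint_ext => x _; rewrite h Im_mul/= mul0r addr0 hq sinN; ring.
by rewrite RintZ ?mulN1r//; exact: integrableI0_cospow_sin.
Qed.

(** The exponential in [annih a] centres the spectrum: the indices [m] and [-(m + 1)] yield the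
    opposite frequencies [a + 2 + 2 m] and [-(a + 2 + 2 m)], so the same moments serve both halves
    of the family. *)
Lemma inner_annih_eq0 a k : -1 < a -> inner (annih a) (Fg (- (a + 1)) k) = 0.
Proof.
move=> ha; case: (leP 0 k) => k0.
  rewrite FgE0// inner_annih//; case: k k0 => // m _.
  by rewrite Rint_cospow_cos_eq0// Rint_cospow_sin_eq0// oppr0.
rewrite FgEN// inner_annih//; case: k k0 => // m _.
rewrite (_ : a + 2 + _ = - (a + 2 + 2 * m%:R)); last first.
  by rewrite NegzE rmorphN/= -natr1; ring.
congr Complex.
  rewrite -[RHS](Rint_cospow_cos_eq0 m ha); apply: Rint_ext => x _.
  by rewrite mulrN mulNr cosN.
rewrite -[RHS](Rint_cospow_sin_eq0 m ha) -RintN; first last.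
  exact: integrableI0_cospow_sin.
by apply: Rint_ext => x _; rewrite mulrN mulNr sinN mulrN opprK.
Qed.

(** * Failure of completeness and of the lower frame bound *)

Lemma Rint_cospow_neq0 (s : R) : -1 < s -> \I (cospow s) <> 0.
Proof.
(* With [cospow s] as weight and [u = 1], a vanishing integral would give [1 = 0]. *)
move=> hs z; have := @positive_weight (cospow s) (fun=> 1).
rewrite Rint_cst => H; suff : (1 : R) = 0 by apply/eqP; rewrite oner_eq0.
apply: H => //.
- by move=> x h; split; [exact: cospow_continuous|apply: powR_gt0; exact: cos_pix_gt0].
- exact: integrableI0_cst.
- by apply: integrableI0_ext (integrableI0_cospow hs) => x _; rewrite mulr1.
- by move=> x _; exact: cospow_ge0.
- by rewrite -[RHS]z; apply: Rint_ext => x _; rewrite mulr1.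
Qed.

Lemma Fg_not_complete xi : xi < - (1/2) -> ~ complete (Fg xi).
Proof.
move=> h c; pose a := - xi - 1.
have xiE : xi = - (a + 1) by rewrite /a; ring.
have ha : - (1/2) < a by rewrite /a; lra.
apply: (@Rint_cospow_neq0 (2 * a)); first lra.
rewrite -norm2_annih; apply: c => [|k]; first exact: L2_annih.
by rewrite xiE inner_annih_eq0//; lra.
Qed.

Lemma Rint_cospow2 : \I (cospow 2) = 1 / 2 :> R.
Proof.
have := @Rint_cospow_rec R 0 ltac:(lra); rewrite !add0r mul1r => H.
have : \I (cospow 0) = 1 :> R.
  by rewrite -[RHS](Rint_cst 1); apply: Rint_ext => x _; rewrite /cospow powRr0.
by lra.
Qed.

(** The reduction formula at [s = -1 + 2 d] has the factor [2 d] on the left, while its right side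
    is at least the integral of [cos^2], which is 1/2, because [1 + 2 d <= 2]. *)
Lemma norm2_annih_ge (d : R) : 0 < d <= 1/2 -> 1 / (4 * d) <= norm2 (annih (- (1/2) + d)).
Proof.
move=> /andP[d0 d1]; rewrite norm2_annih.
have := @Rint_cospow_rec R (2 * (- (1/2) + d)) ltac:(lra).
rewrite (_ : 2 * (- (1/2) + d) + 1 = 2 * d); last by field.
rewrite (_ : 2 * (- (1/2) + d) + 2 = 1 + 2 * d); last by field.
have le : 1 / 2 <= \I (cospow (1 + 2 * d)).
  rewrite -Rint_cospow2; apply: Rint_le => [||x Ix]; try by apply: integrableI0_cospow; lra.
  have := cos_pix_ge0 Ix; rewrite /cospow le_eqVlt => /predU1P[<-|c0].
    by rewrite !powR0// gt_eqF//; lra.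
  by apply: ger_powR; [rewrite c0 cos_le1|lra].
set I1 := \I _; set I2 := \I _ in le * => H.
rewrite ler_pdivrMr; last by lra.
have : I2 <= (1 + 2 * d) * I2 by rewrite ler_peMl//; lra.
by nra.
Qed.

(** The L1 norm is at most [(a + 2) / (a + 1)], which stays below 4 for [a > -1/2]; real and
    imaginary parts then contribute [4^2] each, whatever [d] and [q]. *)
Lemma cabs2_inner_annih_le (d q : R) : 0 < d <= 1/2 ->
  cabs2 (inner (annih (- (1/2) + d)) (E q)) <= 32.
Proof.
move=> /andP[d0 d1]; set a := - (1/2) + d.
have ha : -1 < a by rewrite /a; lra.
have L4 : \I (cospow a) <= 4.
  have := Rint_cospow_rec ha.
  have : \I (cospow (a + 2)) <= 1.
    rewrite -[leRHS](Rint_cst 1); apply: Rint_le => [||x Ix].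
    - by apply: integrableI0_cospow; lra.
    - exact: integrableI0_cst.
    apply: (@le_trans _ _ (1 `^ (a + 2))); last by rewrite powR1.
    by apply: ge0_ler_powR; rewrite ?nnegrE ?cos_pix_ge0 ?cos_le1//; lra.
  have : 0 <= \I (cospow a) by apply: Rintegral_ge0 => x _; exact: cospow_ge0.
  by rewrite /a; nra.
have bd v : integrableI0 (fun x => cospow a x * v x) -> (forall x, `|v x| <= 1) ->
    (\I (fun x => cospow a x * v x)) ^+ 2 <= 16.
  move=> iv v1.
  have : `|\I (fun x => cospow a x * v x)| <= 4.
    apply: le_trans L4.
    apply: le_trans (le_normr_Rintegral (@measurable_I0L R) iv) _.
    apply: Rint_le => [||x _].
    - apply: (integrableI0_le _ _ (integrableI0_cospow ha)).
        by apply: measurableT_comp => //; exact: integrableI0_meas.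
      by move=> x _; rewrite normr_id normrM ger0_norm ?cospow_ge0// ler_piMr ?cospow_ge0.
    - exact: integrableI0_cospow.
    - by rewrite normrM ger0_norm ?cospow_ge0// ler_piMr ?cospow_ge0.
  by rewrite ler_norml => /andP[]; nra.
rewrite inner_annih// /cabs2/= sqrrN.
apply: (@le_trans _ _ (16 + 16)); last by rewrite -natrD.
apply: lerD.
  exact: bd _ (integrableI0_cospow_cos (pi * (a + 2 + 2 * q)) ha) (fun x => cos_max _).
exact: bd _ (integrableI0_cospow_sin (pi * (a + 2 + 2 * q)) ha) (fun x => sin_max _).
Qed.

Lemma cabs2_cexpB1 (d x : R) : 0 <= d <= 1/2 -> I0 x ->
  cabs2 (E (- d) x - 1) <= 2 - 2 * cos (pi * d).
Proof.
move=> hd Ix; rewrite /cabs2 !ReImE/= subr0.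
have := @cos_two_pi_ge d x ltac:(lra) Ix.
rewrite (_ : 2 * pi * - d * x = - (2 * (pi * d * x))); last by ring.
rewrite cosN sinN; set y := 2 * _; have := cos2Dsin2 y; nra.
Qed.

(** The function annihilates the family of [-1/2 - d]. Indices [k >= 0] belong to both families and
    contribute 0. For [k < -n] the frequency exceeds by [d] that of index [k + n < 0] in the
    annihilated family, so the coefficient is one of [(E (- d) - 1) f], and Bessel's inequality
    applies. The remaining [k] lie in [window n], whose size [2 n + 1] is a generous count, and cost
    at most 32 each. *)
Lemma Fg_annih_sum (n : nat) (d : R) s : 0 < d <= 1/2 -> uniq s ->
  \sum_(k <- s) cabs2 (inner (annih (- (1/2) + d)) (Fg (- (1/2) + n%:R) k)) <=
  (2 - 2 * cos (pi * d)) * norm2 (annih (- (1/2) + d)) + 32 * (2 * n).+1%:R.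
Proof.
move=> hd us; have /andP[d0 d1] := hd; set a := - (1/2) + d; set f := annih a.
have ha : - (1/2) < a by rewrite /a; lra.
have ha1 : -1 < a by lra.
have fL : L2 f by exact: L2_annih.
pose m := fun x : R => E (- d) x - 1.
have mm : cmeas m.
  by apply: cmeasD; [exact: cmeas_cexp|exact: cmeas_cst].
have mb x : I0 x -> cabs2 (m x) <= 2 - 2 * cos (pi * d).
  by apply: cabs2_cexpB1; lra.
have mfL := L2_bmul mm mb fL.
pose G := fun x => E (- (- (a + 1))) x * (m x * f x).
have GL : L2 G by exact: L2_cexpM.
have term k : cabs2 (inner f (Fg (- (1/2) + n%:R) k)) <=
    cabs2 (inner G (e (k + n%:Z))) + (if k \in window n then 32 else 0).
  case: (leP 0 k) => k0.
    have := @inner_annih_eq0 a k ha1; rewrite !FgE0// => ->; rewrite cabs2_0.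
    by rewrite addr_ge0 ?cabs2_ge0//; case: ifP.
  case: ifPn => [_|].
    by rewrite FgEN// (le_trans (cabs2_inner_annih_le _ hd))// lerDr cabs2_ge0.
  rewrite mem_window -ltnNge => kn; rewrite addr0.
  have kn0 : k + n%:Z < 0 by lia.
  have := @inner_annih_eq0 a (k + n%:Z) ha1; rewrite !FgEN// => z.
  rewrite -inner_cexp_shift.
  have -> : inner (fun x => m x * f x) (E (- (a + 1) + (k + n%:Z)%:~R)) =
    inner (fun x => E (- d) x * f x) (E (- (a + 1) + (k + n%:Z)%:~R)) -
    inner f (E (- (a + 1) + (k + n%:Z)%:~R)).
    rewrite -innerBl//; [|exact: L2_cexpM|exact: L2_cexp].
    by congr inner; apply/funext => x; rewrite /m mulrBl mul1r.
  rewrite z subr0 inner_cexpM.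
  rewrite (_ : - (a + 1) + (k + n%:Z)%:~R - - d = - (1/2) + n%:R + k%:~R)//.
  by rewrite /a rmorphD/=; lra.
apply: le_trans (ler_sum _ (fun k _ => term k)) _; rewrite big_split/=; apply: lerD.
  apply: (@le_trans _ _ (norm2 G)); last first.
    by rewrite /G norm2_cexpM; exact: norm2_bmul.
  have us' : uniq [seq k + n%:Z | k <- s] by rewrite map_inj_uniq//; exact: addIr.
  by have := bessel us' GL; rewrite big_map.
rewrite -big_mkcond -big_filter big_const_seq/= count_predT iter_addr addr0.
rewrite -[leLHS]mulr_natr ler_wpM2l// ler_nat.
have -> : (2 * n).+1 = size (window n) by rewrite size_map size_iota.
apply: uniq_leq_size; first exact: filter_uniq.
by move=> k; rewrite mem_filter => /andP[].
Qed.

Lemma Fg_not_frame (n : nat) : ~ frame (Fg (- (1/2) + n%:R : R)).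
Proof.
move=> [A [B [A0 [AB h]]]].
pose C : R := 32 * (2 * n).+1%:R.
have C0 : 0 < C by rewrite mulr_gt0.
have key (d : R) : 0 < d <= 1/2 ->
    A * norm2 (annih (- (1/2) + d)) <=
    (2 - 2 * cos (pi * d)) * norm2 (annih (- (1/2) + d)) + C.
  move=> hd; have fL : L2 (annih (- (1/2) + d)) by apply: L2_annih; lra.
  have [le _] := h _ fL; rewrite -lee_fin; apply: le_trans le _.
  by apply: esum_le_seq => s us; exact: Fg_annih_sum.
have A4 : 0 < A / 4 by rewrite divr_gt0.
have := @cosM_continuous R pi 0 => /cvgrPdist_lt /(_ _ A4) /= [r /= r0 hr].
(* [d < r] makes [2 - 2 cos (pi d)] smaller than [A / 2], so [key] gives a squared norm of at most
   [2 C / A]; [d <= A / (16 C)] forces it to be at least [1 / (4 d) >= 4 C / A]. *)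
pose d := Num.min (1/2) (Num.min (r / 2) (A / (16 * C))).
have d0 : 0 < d.
  by rewrite !lt_min !divr_gt0// mulr_gt0.
have d12 : d <= 1/2 by rewrite ge_min lexx.
have dr : d < r.
  by rewrite (@le_lt_trans _ _ (r / 2))//; [rewrite !ge_min lexx orbT|lra].
have dC : d <= A / (16 * C) by rewrite !ge_min lexx !orbT.
have lt : `|cos (pi * 0) - cos (pi * d)| < A / 4.
  by apply: hr; rewrite /ball_/= sub0r normrN ger0_norm// ltW.
rewrite mulr0 cos0 in lt.
have cd : 1 - cos (pi * d) < A / 4 by apply: le_lt_trans lt; exact: ler_norm.
have hd : 0 < d <= 1/2 by rewrite d0.
have := key d hd; have := norm2_annih_ge hd; set N := norm2 _ => N1 N2.
have N0 : 0 < N by apply: lt_le_trans N1; rewrite divr_gt0// mulr_gt0.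
have : A / 2 * N <= C by nra.
have : 4 * C / A <= N.
  apply: le_trans N1; rewrite ler_pdivlMr; last by rewrite mulr_gt0.
  move: dC; rewrite ler_pdivlMr; last by rewrite mulr_gt0.
  rewrite mulrAC ler_pdivrMr//; lra.
rewrite ler_pdivrMr//; nra.
Qed.

End FramesOfExponentials.

(** * Expansions in a frame *)

Section FrameExpansion.
Variable R : realType.
Implicit Types (f g : R -> R[i]) (F : int -> R -> R[i]) (a b : int -> R[i]) (s : seq int).

Definition synth F s a : R -> R[i] := fun x => \sum_(k <- s) a k * F k x.

Lemma L2_synth F s a : (forall k, L2 (F k)) -> L2 (synth F s a).
Proof. by move=> FL; apply: L2_sum => k _; exact: L2Z. Qed.

Lemma synthD F s a b :
  synth F s (fun k => a k + b k) = fun x => synth F s a x + synth F s b x.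
Proof.
by apply/funext => x; rewrite /synth -big_split/=; apply: eq_bigr => k _; rewrite mulrDl.
Qed.

Lemma synthB F s a b :
  synth F s (fun k => a k - b k) = fun x => synth F s a x - synth F s b x.
Proof.
by apply/funext => x; rewrite /synth -sumrB; apply: eq_bigr => k _; rewrite mulrBl.
Qed.

Lemma synth_window F N M a : (N <= M)%N -> (forall k, k \notin window N -> a k = 0) ->
  synth F (window M) a = synth F (window N) a.
Proof.
move=> NM a0; apply/funext => x; rewrite /synth.
rewrite -(big_sub_uniq _ (window_uniq N) (window_uniq M) (window_sub NM)) [RHS]big_mkcond/=.
by apply: eq_bigr => k _; case: ifPn => // /a0 ->; rewrite mul0r.
Qed.

(* Duality: the norm of a synthesis is tested against itself. *)
Lemma norm2_synth_le F (B : R) s a : 0 < B -> (forall k, L2 (F k)) ->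
  (forall f, L2 f -> \sum_(k <- s) cabs2 (inner f (F k)) <= B * norm2 f) ->
  norm2 (synth F s a) <= B * \sum_(k <- s) cabs2 (a k).
Proof.
move=> B0 FL hB; have gL := L2_synth s a FL; set g := synth F s a in gL *.
have gg : norm2 g = \sum_(k <- s) complex.Re (conjc (a k) * inner g (F k)).
  rewrite -[LHS]ReC -inner_norm2 {2}/g inner_sumr//; last by move=> k _; exact: L2Z.
  by rewrite Re_sum; apply: eq_bigr => k _; rewrite innerZr.
have term k : 2 * complex.Re (conjc (a k) * inner g (F k)) <=
    B * cabs2 (a k) + B^-1 * cabs2 (inner g (F k)).
  rewrite /cabs2 !ReImE.
  case: (a k) (inner g (F k)) => [p q] [v w] /=; rewrite -subr_ge0.
  have -> : B * (p ^+ 2 + q ^+ 2) + B^-1 * (v ^+ 2 + w ^+ 2) - 2 * (p * v - - q * w) =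
      B^-1 * ((B * p - v) ^+ 2 + (B * q - w) ^+ 2) by field; rewrite gt_eqF.
  by rewrite mulr_ge0 ?invr_ge0 ?(ltW B0)// addr_ge0// sqr_ge0.
have : 2 * norm2 g <= B * \sum_(k <- s) cabs2 (a k) + norm2 g.
  rewrite {1}gg mulr_sumr; apply: (@le_trans _ _ (\sum_(k <- s)
    (B * cabs2 (a k) + B^-1 * cabs2 (inner g (F k))))); first by apply: ler_sum => k _.
  rewrite big_split/= -!mulr_sumr lerD2l -(ler_pM2l B0) mulrA mulfV ?gt_eqF// mul1r.
  exact: hB.
lra.
Qed.

(* One step [r - B^-1 sum <r, F_k> F_k] of the frame algorithm, truncated to finitely
   many indices, is still a strict contraction. *)
Lemma frame_step F (A B : R) r : 0 < A -> A <= B -> (forall k, L2 (F k)) ->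
  (forall s f, uniq s -> L2 f -> \sum_(k <- s) cabs2 (inner f (F k)) <= B * norm2 f) ->
  L2 r ->
  ((A * norm2 r)%:E <= \esum_(k in [set: int]) (cabs2 (inner r (F k)))%:E)%E ->
  exists N a, [/\ forall k, k \notin window N -> a k = 0,
    norm2 (fun x => r x - synth F (window N) a x) <= (1 - A / (2 * B)) * norm2 r &
    forall s, uniq s -> \sum_(k <- s) cabs2 (a k) <= B^-1 * norm2 r].
Proof.
move=> A0 AB FL hB rL lo; have B0 : 0 < B by lra.
have iB : 0 < B^-1 by rewrite invr_gt0.
have [r0|rn0] := eqVneq (norm2 r) 0.
  exists 0%N, (fun=> 0); split => //.
    rewrite (_ : (fun x => _) = r) ?r0 ?mulr0//.
    by apply/funext => x; rewrite /synth big1 ?subr0// => k _; rewrite mul0r.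
  by move=> s _; rewrite r0 mulr0 big1// => k _; rewrite cabs2_0.
have rp : 0 < norm2 r by rewrite lt_def rn0 norm2_ge0.
(* Half of the lower bound is sacrificed to reach it with a finite sum; hence the factor
   [1 - A / (2 B)]. *)
have : ((A / 2 * norm2 r)%:E < \esum_(k in [set: int]) (cabs2 (inner r (F k)))%:E)%E.
  apply: lt_le_trans lo; rewrite lte_fin ltr_pM2r//; lra.
move=> /esum_gt_seq[s us lt].
have [N sN] := sub_window s.
pose a k : R[i] := if k \in window N then (B^-1)%:C%C * inner r (F k) else 0.
have ae k : k \in window N -> a k = (B^-1)%:C%C * inner r (F k) by rewrite /a => ->.
pose S := \sum_(k <- window N) cabs2 (inner r (F k)).
have Slo : A / 2 * norm2 r <= S.
  apply: (le_trans (ltW lt)); apply: ler_sum_sub => //; first exact: window_uniq.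
  by move=> k; exact: cabs2_ge0.
have Sa : \sum_(k <- window N) cabs2 (a k) = B^-1 ^+ 2 * S.
  rewrite /S mulr_sumr !big_seq; apply: eq_bigr => k kN.
  by rewrite ae// cabs2M /cabs2/= expr0n/= addr0.
have gL := L2_synth (window N) a FL; set g := synth F (window N) a in gL *.
exists N, a; split.
- by move=> k; rewrite /a => /negbTE ->.
- rewrite norm2B//.
  have -> : complex.Re (inner r g) = B^-1 * S.
    rewrite inner_sumr//; last by move=> k _; exact: L2Z.
    rewrite Re_sum /S mulr_sumr !big_seq; apply: eq_bigr => k kN.
    by rewrite innerZr// ae// /cabs2 !ReImE/=; ring.
  have : norm2 g <= B * (B^-1 ^+ 2 * S).
    by rewrite -Sa; apply: norm2_synth_le => // f fL; apply: hB => //; exact: window_uniq.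
  rewrite (_ : B * (B^-1 ^+ 2 * S) = B^-1 * S); last by field; rewrite gt_eqF.
  rewrite (_ : (1 - A / (2 * B)) * norm2 r = norm2 r - B^-1 * (A / 2 * norm2 r)); last first.
    by field; rewrite gt_eqF.
  have : B^-1 * (A / 2 * norm2 r) <= B^-1 * S by rewrite ler_wpM2l// ltW.
  lra.
- move=> t ut; apply: (@le_trans _ _ (\sum_(k <- t) B^-1 ^+ 2 * cabs2 (inner r (F k)))).
    apply: ler_sum => k _; rewrite /a; case: ifP => _.
      by rewrite cabs2M {1}/cabs2/= expr0n/= addr0.
    by rewrite cabs2_0 mulr_ge0 ?cabs2_ge0// sqr_ge0.
  rewrite -mulr_sumr expr2 -mulrA ler_wpM2l ?(ltW iB)//.
  by rewrite -(ler_pM2l B0) mulrA mulfV ?gt_eqF// mul1r; exact: hB.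
Qed.

Lemma geometric_small (K th eps : R) : 0 <= th < 1 -> 0 < eps ->
  exists J, K * th ^+ J < eps.
Proof.
move=> th01 e0; have : K * th ^+ n @[n --> \oo] --> (0 : R).
  rewrite -(mulr0 K); apply: cvgM; first exact: cvg_cst.
  by have /andP[t0 t1] := th01; apply: cvg_expr; rewrite ger0_norm.
move=> /cvgrPdist_lt /(_ _ e0)[J _ /(_ J (leqnn J))] /=; rewrite sub0r normrN => h.
by exists J; apply: le_lt_trans h; exact: ler_norm.
Qed.

Lemma coef_cvg (b : nat -> int -> R[i]) (K th : R) k : 0 <= th < 1 ->
  (forall J m s, uniq s ->
    \sum_(k <- s) cabs2 (b (J + m)%N k - b J k) <= K * th ^+ J) ->
  exists z : R[i], complex.Re (b n k) @[n --> \oo] --> complex.Re z /\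
  complex.Im (b n k) @[n --> \oo] --> complex.Im z.
Proof.
move=> th01 bK; have one J m : cabs2 (b (J + m)%N k - b J k) <= K * th ^+ J.
  by have := @bK J m [:: k] isT; rewrite big_seq1.
have cv (u : nat -> R) : (forall J m, (u (J + m)%N - u J) ^+ 2 <= K * th ^+ J) ->
    cvg (u n @[n --> \oo]).
  move=> hu; apply/cauchy_cvgP/cauchy_exP => eps e0.
  have [J hJ] := geometric_small K th01 (exprn_gt0 2 e0).
  exists (u J); exists J => // n /= Jn.
  rewrite /ball/= distrC -ltr_sqr ?nnegrE ?(ltW e0)// -normrX ger0_norm ?sqr_ge0//.
  by apply: le_lt_trans hJ; rewrite -(subnKC Jn).
have c1 : cvg (complex.Re (b n k) @[n --> \oo]).
  apply: cv => J m; apply: le_trans (one J m); rewrite /cabs2 !ReImE lerDl; exact: sqr_ge0.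
have c2 : cvg (complex.Im (b n k) @[n --> \oo]).
  apply: cv => J m; apply: le_trans (one J m); rewrite /cabs2 !ReImE lerDr; exact: sqr_ge0.
by exists (Complex (limn (fun n => complex.Re (b n k))) (limn (fun n => complex.Im (b n k)))).
Qed.

(** The bound is uniform in [m] and concerns finite sums only, so it passes to the limit taken index
    by index. *)
Lemma coef_limit (b : nat -> int -> R[i]) (K th : R) : 0 <= th < 1 ->
  (forall J m s, uniq s ->
    \sum_(k <- s) cabs2 (b (J + m)%N k - b J k) <= K * th ^+ J) ->
  exists al : int -> R[i], forall J s, uniq s ->
    \sum_(k <- s) cabs2 (al k - b J k) <= K * th ^+ J.
Proof.
move=> th01 bK; have [al hal] := choice (fun k => coef_cvg k th01 bK); exists al => J s us.
have c : \sum_(k <- s) cabs2 (b (m + J)%N k - b J k) @[m --> \oo] -->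
    \sum_(k <- s) cabs2 (al k - b J k).
  elim: s us => [|k s IH] us.
    by under eq_fun do rewrite big_nil; rewrite big_nil; exact: cvg_cst.
  under eq_fun do rewrite big_cons; rewrite big_cons.
  apply: cvgD; last by apply: IH; case/andP: us.
  have [h1 h2] := hal k; rewrite /cabs2 !ReImE.
  under eq_fun do rewrite !ReImE.
  have aux (u : nat -> R) l c : u n @[n --> \oo] --> l ->
      (u (m + J)%N - c) ^+ 2 @[m --> \oo] --> (l - c) ^+ 2.
    rewrite -(cvg_shiftn J) => hu; rewrite expr2; under eq_fun do rewrite expr2.
    by apply: cvgM; apply: cvgB => //; exact: cvg_cst.
  apply: cvgD; first exact: (aux (fun n => complex.Re (b n k)) _ _ h1).
  exact: (aux (fun n => complex.Im (b n k)) _ _ h2).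
apply: (@closed_cvg _ _ _ _ _ (fun y => y <= K * th ^+ J) _ _ _ c).
  exact: closed_le.
by apply: nearW => m; rewrite addnC; exact: bK.
Qed.

(** The residuals decay geometrically, and so do the increments of the accumulated coefficients
    [b n]; replacing [b J] by the limit [al] costs at most [B K th^J] by [norm2_synth_le]. *)
Lemma frame_expansion F : (forall k, L2 (F k)) -> frame F ->
  forall f, L2 f -> exists al, expansion F f al.
Proof.
move=> FL [A [B [A0 [AB h]]]] f fL; have B0 : 0 < B by lra.
have hB s g : uniq s -> L2 g -> \sum_(k <- s) cabs2 (inner g (F k)) <= B * norm2 g.
  by move=> us gL; rewrite -lee_fin; apply: le_trans (proj2 (h g gL)); exact: seq_le_esum.
pose th := 1 - A / (2 * B).
have th01 : 0 <= th < 1.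
  have : A / (2 * B) <= 1 by rewrite ler_pdivrMr; lra.
  have : 0 < A / (2 * B) by rewrite divr_gt0// mulr_gt0.
  by rewrite /th => *; apply/andP; split; lra.
(* The residual carries its membership in L2, so that [choice] yields a step that can be
   iterated. *)
pose sR := {r : R -> R[i] | L2 r}.
have step (r : sR) : exists na : nat * (int -> R[i]),
  [/\ forall k, k \notin window na.1 -> na.2 k = 0,
    norm2 (fun x => sval r x - synth F (window na.1) na.2 x) <= th * norm2 (sval r) &
    forall s, uniq s -> \sum_(k <- s) cabs2 (na.2 k) <= B^-1 * norm2 (sval r)].
  case: r => r rL /=; have [N [a [h1 h2 h3]]] := frame_step A0 AB FL hB rL (proj1 (h r rL)).
  by exists (N, a).
have [st hst] := choice step.
have nextL (r : sR) : L2 (fun x => sval r x - synth F (window (st r).1) (st r).2 x).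
  by apply: L2B; [exact: (svalP r)|exact: L2_synth].
pose next (r : sR) : sR := exist _ _ (nextL r).
pose res (n : nat) : sR := iter n next (exist _ f fL).
pose cf (n : nat) := (st (res n)).2.
pose b (n : nat) (k : int) : R[i] := \sum_(i < n) cf i k.
have resS n : sval (res n.+1) =
  fun x => sval (res n) x - synth F (window (st (res n)).1) (cf n) x by [].
have resN n : norm2 (sval (res n)) <= th ^+ n * norm2 f.
  elim: n => [|n IH]; first by rewrite expr0 mul1r.
  have [_ le _] := hst (res n).
  rewrite resS; apply: (le_trans le); rewrite exprS -mulrA ler_wpM2l//; lra.
have Nn n : exists N, (forall k, k \notin window N -> b n k = 0) /\
    sval (res n) = fun x => f x - synth F (window N) (b n) x.
  elim: n => [|n [N [hN1 hN2]]].
    exists 0%N; split; first by move=> k _; rewrite /b big_ord0.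
    apply/funext => x; rewrite /synth big1 ?subr0// => k _.
    by rewrite /b big_ord0 mul0r.
  have [h1 _ _] := hst (res n); rewrite -/(cf n) in h1; set N' := (st (res n)).1 in h1.
  have bS : b n.+1 = fun k => b n k + cf n k.
    by apply/funext => k; rewrite /b big_ord_recr.
  exists (maxn N N'); split.
    move=> k kM; rewrite bS hN1 ?h1 ?addr0//.
      by apply/negP => /(window_sub (leq_maxr N N')) kk; rewrite kk in kM.
    by apply/negP => /(window_sub (leq_maxl N N')) kk; rewrite kk in kM.
  rewrite resS hN2 bS synthD; apply/funext => x.
  rewrite (synth_window F (leq_maxl N N') hN1) (synth_window F (leq_maxr N N') h1).
  by rewrite opprD addrA.
(* From [t >= 2 th / (1 - th)], the ratio [(1 + t^-1) th] is at most [(1 + th) / 2], still below 1;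
   the summand 1 ensures [t > 0]. *)
pose t := 2 * th / (1 - th) + 1.
have t0 : 0 < t.
  by rewrite ltr_wpDl// divr_ge0 ?mulr_ge0//; lra.
have q1 : (1 + t^-1) * th <= (1 + th) / 2.
  rewrite mulrDl mul1r -[X in _ <= X](subrK th) addrC lerD2r.
  rewrite mulrC ler_pdivrMr//.
  have : 2 * th / (1 - th) * ((1 - th) / 2) = th by field; lra.
  by rewrite /t; nra.
pose C := B^-1 * norm2 f + 1.
have C0 : 0 < C by rewrite ltr_wpDl// mulr_ge0 ?norm2_ge0// invr_ge0 ltW.
(* [K] is the fixed point of [K = (1 + t) C + (1 + th) / 2 * K], which lets the induction in [bK]
   reproduce its own bound. *)
pose K := (1 + t) * C / (1 - (1 + th) / 2).
have den : 0 < 1 - (1 + th) / 2 by lra.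
have K0 : 0 < K by rewrite divr_gt0// mulr_gt0//; lra.
have KE : (1 + t) * C + (1 + th) / 2 * K = K by rewrite /K; field; lra.
have cfb n s : uniq s -> \sum_(k <- s) cabs2 (cf n k) <= C * th ^+ n.
  move=> us; have [_ _ le] := hst (res n).
  apply: (le_trans (le s us)); apply: (@le_trans _ _ (B^-1 * (th ^+ n * norm2 f))).
    by rewrite ler_wpM2l// invr_ge0 ltW.
  have : 0 <= th ^+ n by rewrite exprn_ge0//; lra.
  by rewrite /C; set z := th ^+ n; lra.
have thK J : 0 <= K * th ^+ J.
  by apply: mulr_ge0; [exact: ltW|apply: exprn_ge0; lra].
have bK J m s : uniq s -> \sum_(k <- s) cabs2 (b (J + m)%N k - b J k) <= K * th ^+ J.
  move=> us; elim: m J => [|m IH] J.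
    rewrite addn0 big1; first exact: thK.
    by move=> k _; rewrite subrr cabs2_0.
  apply: (@le_trans _ _ (\sum_(k <- s) ((1 + t) * cabs2 (cf J k) +
      (1 + t^-1) * cabs2 (b (J.+1 + m)%N k - b J.+1 k)))).
    apply: ler_sum => k _; rewrite addnS -addSn.
    rewrite (_ : b (J.+1 + m)%N k - b J k = cf J k + (b (J.+1 + m)%N k - b J.+1 k)).
      exact: cabs2D_le.
    by rewrite [b J.+1 k]/b big_ord_recr/= -/(b J k); ring.
  rewrite big_split/= -!mulr_sumr.
  have u1 : (1 + t) * \sum_(k <- s) cabs2 (cf J k) <= (1 + t) * (C * th ^+ J).
    by rewrite ler_wpM2l ?cfb//; lra.
  have u2 : (1 + t^-1) * \sum_(k <- s) cabs2 (b (J.+1 + m)%N k - b J.+1 k) <=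
      (1 + t^-1) * (K * th ^+ J.+1).
    by rewrite ler_wpM2l// addr_ge0// invr_ge0 ltW.
  apply: (le_trans (lerD u1 u2)).
  rewrite -[X in _ <= X * _]KE exprS.
  have := ler_wpM2r (thK J) q1; set z := th ^+ J; lra.
have [al hal] := coef_limit th01 bK.
exists al; rewrite /expansion; apply/cvgrPdist_lt => eps e0.
have [J hJ] := geometric_small (2 * norm2 f + 2 * B * K) th01 e0.
have [N [hN1 hN2]] := Nn J.
exists N => // n /= Nn'; rewrite sub0r normrN ger0_norm ?norm2_ge0//.
apply: le_lt_trans hJ.
(* Since [n >= N], the window contains the support of [b J], and the error is the residual [res J]
   minus the synthesis of [al - b J]. *)
have -> : (fun x => f x - psum al F n x) =
    fun x => sval (res J) x - synth F (window n) (fun k => al k - b J k) x.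
  rewrite psumE hN2 synthB (synth_window F Nn' hN1); apply/funext => x.
  by rewrite /synth; ring.
apply: le_trans (norm2B_le2 (svalP (res J)) (L2_synth _ _ FL)) _.
have : norm2 (synth F (window n) (fun k => al k - b J k)) <= B * (K * th ^+ J).
  apply: le_trans (norm2_synth_le (B := B) _ _ _ _) _ => //.
    by move=> g gL; apply: hB => //; exact: window_uniq.
  by rewrite ler_wpM2l ?(ltW B0)//; apply: hal; exact: window_uniq.
have := resN J; lra.
Qed.

End FrameExpansion.

(** * Riesz bases *)

Section RieszBases.
Variable R : realType.
Implicit Types (f : R -> R[i]) (F : int -> R -> R[i]) (al be : int -> R[i]) (xi : R).

(** If the coefficients differ at [k], [Fg_sum_lower] keeps the partial sums at squared distance at
    least [x], whereas both come within [x / 8] of [f] and hence within [x / 2] of each other. *)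
Lemma expansion_unique xi f al be : - (1/2) < xi < 1/2 -> L2 f ->
  expansion (Fg xi) f al -> expansion (Fg xi) f be -> al = be.
Proof.
move=> h fL ha hb; apply/funext => k; apply/eqP; rewrite -subr_eq0; apply/eqP.
apply: cabs2_eq0; apply/eqP; apply/negP => /negP nz.
have A0 := lower_bound_gt0 h; set x := lower_bound xi * cabs2 (al k - be k).
have x0 : 0 < x by rewrite mulr_gt0// lt_def nz cabs2_ge0.
have x8 : 0 < x / 8 by rewrite divr_gt0.
have /cvgrPdist_lt /(_ _ x8)[N1 _ h1] := ha; have /cvgrPdist_lt /(_ _ x8)[N2 _ h2] := hb.
(* The term [|k|] puts the index [k] inside the window. *)
pose N := maxn (maxn N1 N2) `|k|%N.
have := h1 N (leq_trans (leq_maxl N1 N2) (leq_maxl _ _)).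
have := h2 N (leq_trans (leq_maxr N1 N2) (leq_maxl _ _)).
rewrite /= !sub0r !normrN !ger0_norm ?norm2_ge0//.
have FL k' : L2 (Fg xi k') by exact: L2_Fg.
have pL a : L2 (psum a (Fg xi) N) by rewrite psumE; exact: (L2_synth (window N) a FL).
move=> lb la; suff : x <= 2 * (x / 8) + 2 * (x / 8) by lra.
apply: (@le_trans _ _ (norm2 (synth (Fg xi) (window N) (fun k => al k - be k)))).
  have := Fg_sum_lower (fun k => al k - be k) h (window_uniq N); apply: le_trans.
  rewrite /x ler_wpM2l ?(ltW A0)//.
  have kN : {subset [:: k] <= window N}.
    by move=> j; rewrite inE mem_window => /eqP ->; exact: leq_maxr.
  have := @ler_sum_sub R [:: k] (window N) (fun k => cabs2 (al k - be k)) isT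
    (window_uniq N) kN (fun k => cabs2_ge0 _).
  by rewrite big_seq1.
have -> : synth (Fg xi) (window N) (fun k => al k - be k) =
    fun x => (f x - psum be (Fg xi) N x) - (f x - psum al (Fg xi) N x).
  by rewrite synthB !psumE; apply/funext => y; rewrite /synth; ring.
apply: le_trans (norm2B_le2 (L2B fL (pL be)) (L2B fL (pL al))) _; lra.
Qed.

Lemma Fg_riesz_basis xi : - (1/2) < xi < 1/2 -> riesz_basis (Fg xi).
Proof.
move=> h; have fr : frame (Fg xi) by have := Fg_frame 0 h; rewrite addr0.
split => // f fL; have [al hal] := frame_expansion (@L2_Fg R xi) fr fL.
by exists al; split => // be; exact: expansion_unique.
Qed.

Lemma inner0r f : inner f (fun=> 0) = 0.
Proof.
by apply: complexP; rewrite ?Re_inner ?Im_inner -[RHS](Rint_cst 0);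
   apply: Rint_ext => x _; rewrite !ReImE/=; ring.
Qed.

(* For [n >= 1] the vector of index [-1] is redundant: masking it by 0 leaves a frame,
   which yields a second expansion of that vector. *)
Lemma Fg_not_riesz xi n : (0 < n)%N -> - (1/2) < xi < 1/2 ->
  ~ riesz_basis (Fg (xi + n%:R)).
Proof.
move=> n0 h [_ uq]; set F := Fg (xi + n%:R).
pose F' (k : int) : R -> R[i] := if k == -1 then fun=> 0 else F k.
have F'L k : L2 (F' k) by rewrite /F'; case: ifP => _; [exact: L2_cst|exact: L2_Fg].
have fr' : frame F'.
  exists (lower_bound xi), 2; split; first exact: lower_bound_gt0.
  split; first exact: lower_bound_le2.
  move=> f fL; split.
    apply: esum_ge_seq => d d0; have [s us lt] := Fg_lower h fL d0.
    exists [seq shift_index n k | k <- s]; first by rewrite map_inj_uniq//; exact: shift_index_inj.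
    rewrite big_map; apply: lt_le_trans lt _; apply: ler_sum => k _.
    rewrite /F' ifF; first by rewrite /F Fg_shift_index.
    by rewrite /shift_index; case: (leP 0 k); lia.
  apply: esum_le_seq => s us.
  apply: le_trans (@Fg_bessel R (xi + n%:R) s f us fL); apply: ler_sum => k _.
  by rewrite /F'; case: ifP => // _; rewrite inner0r cabs2_0 cabs2_ge0.
have [al hal] := frame_expansion F'L fr' (L2_Fg (xi + n%:R) (-1)).
pose al' (k : int) : R[i] := if k == -1 then 0 else al k.
pose de (k : int) : R[i] := if k == -1 then 1 else 0.
have [ga [_ gau]] := uq _ (L2_Fg (xi + n%:R) (-1)).
(* Two expansions of the same vector, with coefficient 0 and 1 at the index [-1]. *)
have e1 : expansion F (F (-1)) al'.
  rewrite /expansion (_ : psum al' F = psum al F')//.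
  apply/funext => N; rewrite !psumE; apply/funext => x; apply: eq_bigr => k _.
  by rewrite /al' /F'; case: ifP => _; rewrite ?mul0r ?mulr0.
have e2 : expansion F (F (-1)) de.
  rewrite /expansion; apply: cvg_near_cst; exists 1%N => // N /= N1.
  rewrite (_ : (fun x => _) = fun=> 0) ?norm2_0//; apply/funext => x.
  rewrite psumE (big_rem (-1)); last by rewrite mem_window; lia.
  rewrite big1_seq; first by rewrite Monoid.mulm1 /de eqxx mul1r subrr.
  move=> k /andP[_]; rewrite /de mem_rem_uniq ?window_uniq// inE => /andP[/negbTE -> _].
  by rewrite mul0r.
have := gau _ e1; rewrite (gau _ e2) => /(congr1 (fun u => u (-1))).
by rewrite /al' /de eqxx => /eqP; rewrite oner_eq0.
Qed.

End RieszBases.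

Unset Implicit Arguments.

Theorem mainTheorem8 (R : realType) (xi : R) :
  (xi < - (1/2) -> ~ complete (Fg xi)) /\
  (- (1/2) < xi < 1/2 -> riesz_basis (Fg xi)) /\
  (forall n : nat, (1 <= n)%N -> n%:R - 1/2 < xi < n%:R + 1/2 ->
     frame (Fg xi) /\ ~ riesz_basis (Fg xi)) /\
  (forall n : nat, xi = n%:R - 1/2 ->
     complete (Fg xi) /\ ~ riesz_basis (Fg xi) /\ ~ frame (Fg xi)).
Proof.
split; first exact: Fg_not_complete.
split; first exact: Fg_riesz_basis.
split=> n.
  move=> n1 hxi; have h : - (1/2) < xi - n%:R < 1/2 by lra.
  rewrite -(subrK n%:R xi); split; first exact: Fg_frame.
  exact: Fg_not_riesz.
move=> ->; rewrite addrC; split.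
  exact: complete_shift_index (@Fg_complete_Nhalf R).
by split => [[fr _]|]; [exact: (@Fg_not_frame R n fr)|exact: Fg_not_frame].
Qed.
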